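(* Assume that the coefficients satisfy (H1) and (H2) as listed in the context. Then the Riccati equations $$\begin{cases}\dot\Sigma-A\Sigma-\Sigma A^\top-\Sigma Q\Sigma+BR_2^{-1}B^\top+C(I+\Sigma R_1)^{-1}\Sigma C^\top=0,\quad s\in[0,T],\\ \Sigma(T)=0,\end{cases}$$ and $$\begin{cases}\dot\Gamma-(A+\bar A)\Gamma-\Gamma(A+\bar A)^\top-\Gamma(Q+\bar Q)\Gamma+(B+\bar B)(R_2+\bar R_2)^{-1}(B+\bar B)^\top\\ \qquad+(C+\bar C)(I+\Sigma R_1+\Sigma\bar R_1)^{-1}\Sigma(C+\bar C)^\top=0,\quad s\in[0,T],\\ \Gamma(T)=0,\end{cases}$$ where the $\Sigma$ appearing in the second equation is the solution of the first, admit unique solutions $\Sigma(\cdot)\in C([0,T];\overline{\mathbb S^n_+})$ and $\Gamma(\cdot)\in C([0,T];\overline{\mathbb S^n_+})$, respectively.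
   Context: Fix $T>0$ and positive integers $n,m$. $\mathbb S^n$ is the space of symmetric real $n\times n$ matrices, $\mathbb S^n_+$ the set of positive definite ones, and $\overline{\mathbb S^n_+}$ its closure (the positive semidefinite matrices). For symmetric $M,N$, $M\ge N$ means $M-N\in\overline{\mathbb S^n_+}$. $\top$ denotes transpose; $C([0,T];\cdot)$ denotes continuous functions. The time argument $s$ is suppressed in equations, the dot denotes $d/ds$, and a solution is understood as an absolutely continuous function satisfying the equation for a.e. $s\in[0,T]$ (equivalently, satisfying the corresponding integral equation). (H1): the coefficients satisfy $A,\bar A\in L^1(0,T;\mathbb R^{n\times n})$, $B,\bar B\in L^2(0,T;\mathbb R^{n\times m})$, $C,\bar C\in L^2(0,T;\mathbb R^{n\times n})$. (H2): $G,\bar G\in\mathbb S^n$; $Q,\bar Q\in L^1(0,T;\mathbb S^n)$, $R_1,\bar R_1\in L^\infty(0,T;\mathbb S^n)$, $R_2,\bar R_2\in L^\infty(0,T;\mathbb S^m)$; and there is a constant $\delta>0$ such that for a.e. $s\in[0,T]$: $G\ge0$, $G+\bar G\ge0$, $Q(s)\ge0$, $Q(s)+\bar Q(s)\ge0$, $R_1(s)\ge0$, $R_1(s)+\bar R_1(s)\ge0$, $R_2(s)\ge\delta I$, $R_2(s)+\bar R_2(s)\ge\delta I$. (The matrices $G,\bar G$ do not enter the two Riccati equations.) *)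

(* Defs.v *)
From HB Require Import structures.
From mathcomp Require Import all_boot all_order all_algebra.
From mathcomp Require Import all_classical all_reals all_analysis.

Set Implicit Arguments.
Unset Strict Implicit.
Unset Printing Implicit Defensive.

Import Order.TTheory GRing.Theory Num.Theory.
Import numFieldNormedType.Exports.

Local Open Scope classical_set_scope.
Local Open Scope ring_scope.

Section Matrices.
Context {R : realType} {n : nat}.
Implicit Types M N : 'M[R]_n.

Definition symmetric_mx M : Prop := M^T = M.

Definition psd_mx M : Prop :=
  symmetric_mx M /\ forall x : 'cV[R]_n, 0 <= (x^T *m M *m x) ord0 ord0.

(* the Loewner order, to be used on symmetric M and N *)
Definition mx_ge M N : Prop := psd_mx (M - N).

End Matrices.

Section TimeDependent.
Context {R : realType}.

(* "P s for almost every s in [0, T]" *)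
Definition ae_on (T : R) (P : R -> Prop) : Prop :=
  {ae (@lebesgue_measure R), forall s, `[0, T]%classic s -> P s}.

(* M \in L^p(0, T; R^(k x l)): every entry, extended by zero outside [0, T],
   belongs to the library's L^p; p may be +oo *)
Definition Lp_mx (p : \bar R) (T : R) (k l : nat) (M : R -> 'M[R]_(k, l)) :
    Prop :=
  forall i j, ((fun s => M s i j) \_ `[0, T]) \in Lfun (@lebesgue_measure R) p.

Definition Lp_sym_mx (p : \bar R) (T : R) (k : nat) (M : R -> 'M[R]_k) : Prop :=
  Lp_mx p T M /\ ae_on T (fun s => symmetric_mx (M s)).

Definition absolutely_continuous_on (V : normedModType R) (a b : R)
    (f : R -> V) : Prop :=
  forall e : R, 0 < e -> exists2 d : R, 0 < d &
    forall (N : nat) (x y : 'I_N -> R),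
      (forall i, [/\ a <= x i, x i <= y i & y i <= b]) ->
      trivIset [set: 'I_N] (fun i => `]x i, y i[%classic) ->
      \sum_(i < N) (y i - x i) < d ->
      \sum_(i < N) `|f (y i) - f (x i)| < e.

(* S \in C([0, T]; closure of S^n_+); values outside [0, T] are irrelevant *)
Definition C_psd (T : R) (n : nat) (S : R -> 'M[R]_n) : Prop :=
  {within `[0, T], continuous S} /\ forall s, `[0, T]%classic s -> psd_mx (S s).

Section Riccati.
Context {n m : nat} (T : R).

(* invmx is the identity on singular matrices; this is immaterial here, since
   1%:M + Sigma *m R1 is invertible whenever Sigma and R1 are positive
   semidefinite, and R2 whenever R2 >= delta%:M with delta > 0.
   The two-sided derivative is only demanded almost everywhere, so the
   endpoints of [0, T] play no role. *)
Definition sigma_solution (A : R -> 'M[R]_n) (B : R -> 'M[R]_(n, m))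
    (C Q R1 : R -> 'M[R]_n) (R2 : R -> 'M[R]_m) (Sigma : R -> 'M[R]_n) :
    Prop :=
  [/\ absolutely_continuous_on 0 T Sigma,
      ae_on T (fun s => derivable Sigma s 1 /\
        derive1 Sigma s - A s *m Sigma s - Sigma s *m (A s)^T
        - Sigma s *m Q s *m Sigma s
        + B s *m invmx (R2 s) *m (B s)^T
        + C s *m invmx (1%:M + Sigma s *m R1 s) *m Sigma s *m (C s)^T = 0)
    & Sigma T = 0].

Definition gamma_solution (A A' : R -> 'M[R]_n) (B B' : R -> 'M[R]_(n, m))
    (C C' Q Q' R1 R1' : R -> 'M[R]_n) (R2 R2' : R -> 'M[R]_m)
    (Sigma Gamma : R -> 'M[R]_n) : Prop :=
  [/\ absolutely_continuous_on 0 T Gamma,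
      ae_on T (fun s => derivable Gamma s 1 /\
        derive1 Gamma s - (A s + A' s) *m Gamma s - Gamma s *m (A s + A' s)^T
        - Gamma s *m (Q s + Q' s) *m Gamma s
        + (B s + B' s) *m invmx (R2 s + R2' s) *m (B s + B' s)^T
        + (C s + C' s)
          *m invmx (1%:M + Sigma s *m R1 s + Sigma s *m R1' s) *m Sigma s
          *m (C s + C' s)^T = 0)
    & Gamma T = 0].

End Riccati.

End TimeDependent.

(* Main.v *)
Require Import Defs.
From HB Require Import structures.
From mathcomp Require Import all_boot all_order all_algebra.
From mathcomp Require Import all_classical all_reals all_analysis.
From mathcomp Require Import measurable_realfun ess_sup_inf.
From mathcomp Require Import ring lra.

Set Implicit Arguments.
Unset Strict Implicit.
Unset Printing Implicit Defensive.

Import Order.TTheory GRing.Theory Num.Theory.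
Import numFieldNormedType.Exports.

Local Open Scope classical_set_scope.
Local Open Scope ring_scope.

(** Put [S = B R2^-1 B^T], which is positive semidefinite.  The first equation is
    a terminal value problem
    [Y' = A Y + Y A^T + Y Q Y - S - C (I + Y R1)^-1 Y C^T], [Y T = 0], with
    integrable coefficients, and the second one has the same shape with [C] and
    [R1] replaced by zero and the term that contains Sigma moved into [S]; so
    one existence and uniqueness theorem suffices ([riccati_exists_unique],
    relaxed to almost everywhere hypotheses in [riccati_ae]).

    For positive semidefinite [Y] and [W] the matrix [(I + Y W)^-1 Y] is well
    defined, satisfies [0 <= (I + Y W)^-1 Y <= Y] and is Lipschitz in [Y] on
    bounded sets ([resolvent_psd], [resolvent_le], [resolvent_lipschitz]).  The
    right-hand side is made globally Lipschitz ([riccati_trunc]): the unknown is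
    symmetrized, truncated radially at a level [r], and retracted onto the
    positive semidefinite cone by adding to it the negative part of its smallest
    eigenvalue times the identity.  Picard iteration in an exponentially
    weighted norm then gives a unique global Caratheodory solution
    ([caratheodory_exists], [caratheodory_unique]).

    The modification is harmless for two reasons.  First, it keeps the shape
    [Y' = D Y + Y D^T - V] with [V] positive semidefinite, so that
    [x^T Y x] decreases to zero at the time [T] along any solution of
    [x' = - D^T x], and [Y] is positive semidefinite ([lyapunov_psd]).  Second,
    the trace of [Y] satisfies a linear differential inequality that does not
    involve [r], because the quadratic term has a sign and the resolvent is at
    most [Y]; so [Y] is bounded independently of [r] ([riccati_trunc_bound]) and
    solves the original equation once [r] is large.  Two solutions of the
    original equation are both solutions of the modified one for large [r],
    hence equal.

    Everything rests on one fact of real analysis: an absolutely continuous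
    function whose derivative is nonnegative almost everywhere is nondecreasing
    ([ac_nondecreasing]).  Comparison of derivatives then replaces integration
    in all estimates; integrals occur only to produce a primitive of an
    integrable function ([integrable_primitive]). *)

(** * Absolutely continuous functions *)

Section AbsoluteContinuity.
Context {R : realType}.
Local Notation mu := (@lebesgue_measure R).

Lemma ac_sub (V : normedModType R) (a b a' b' : R) (f : R -> V) :
  a <= a' -> b' <= b ->
  absolutely_continuous_on a b f -> absolutely_continuous_on a' b' f.
Proof.
move=> aa bb acf e e0; have [d d0 H] := acf e e0.
exists d => // N x y hxy; apply: H => i; have [h1 h2 h3] := hxy i.
by split => //; [exact: le_trans h1|exact: le_trans bb].
Qed.

Lemma ac_dominated (U V W : normedModType R) (a b K : R)
    (f : R -> U) (g : R -> V) (h : R -> W) :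
  absolutely_continuous_on a b f -> absolutely_continuous_on a b g ->
  (forall x y, a <= x -> x <= y -> y <= b ->
     `|h y - h x| <= K * (`|f y - f x| + `|g y - g x|)) ->
  absolutely_continuous_on a b h.
Proof.
move=> acf acg hh e e0.
pose K' := `|K| + 1.
have K'0 : 0 < K' by rewrite ltr_wpDl.
have e'0 : 0 < e / (2 * K') by rewrite divr_gt0// mulr_gt0.
have [d1 d10 H1] := acf _ e'0.
have [d2 d20 H2] := acg _ e'0.
exists (Num.min d1 d2); first by rewrite lt_min d10.
move=> N x y hxy tI; rewrite lt_min => /andP[s1 s2].
have {H1} := H1 N x y hxy tI s1; have {H2} := H2 N x y hxy tI s2.
set Sg := (X in X < _ -> _); set Sf := (X in _ -> X < _ -> _) => hg hf.
apply: (@le_lt_trans _ _ (K' * (Sf + Sg))).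
  rewrite -big_split/= mulr_sumr ler_sum// => i _; have [h1 h2 h3] := hxy i.
  apply: (le_trans (hh _ _ h1 h2 h3)); rewrite ler_wpM2r ?addr_ge0//.
  by rewrite (le_trans (ler_norm _))// lerDl.
have -> : e = K' * (e / (2 * K') + e / (2 * K')) by field; lra.
by rewrite ltr_pM2l// ltrD.
Qed.

Lemma ac_lipschitz (V W : normedModType R) (a b K : R) (f : R -> V)
    (h : R -> W) :
  absolutely_continuous_on a b f ->
  (forall x y, a <= x -> x <= y -> y <= b ->
     `|h y - h x| <= K * `|f y - f x|) ->
  absolutely_continuous_on a b h.
Proof.
move=> acf hh.
apply: (@ac_dominated _ _ _ _ _ (`|K|) _ _ _ acf acf) => x y ax xy yb.
apply: (le_trans (hh _ _ ax xy yb)).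
apply: (@le_trans _ _ (`|K| * `|f y - f x|)).
  by rewrite ler_wpM2r// ler_norm.
by rewrite ler_wpM2l// lerDl.
Qed.

Lemma ac_uniform (V : normedModType R) (a b : R) (f : R -> V) :
  absolutely_continuous_on a b f ->
  forall e, 0 < e -> exists2 d, 0 < d &
    forall x y, `[a, b]%classic x -> `[a, b]%classic y -> `|x - y| < d ->
      `|f x - f y| < e.
Proof.
move=> acf e e0; have [d d0 H] := acf e e0; exists d => //.
have H1 x y : a <= x -> x <= y -> y <= b -> y - x < d -> `|f y - f x| < e.
  move=> ax xy yb yx.
  have := H 1%N (fun=> x) (fun=> y); rewrite !big_ord1; apply => //.
  by move=> i j _ _ _; rewrite !ord1.
move=> x y /=; rewrite !in_itv/= => /andP[ax xb] /andP[ay yb].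
have [xy|/ltW xy] := leP x y.
  rewrite ler0_norm ?subr_le0// opprB => ?; rewrite distrC; exact: H1.
by rewrite ger0_norm ?subr_ge0// => ?; exact: H1.
Qed.

Lemma ac_continuous (V : normedModType R) (a b : R) (f : R -> V) :
  absolutely_continuous_on a b f -> {within `[a, b], continuous f}.
Proof.
move=> /ac_uniform acf.
apply/subspace_continuousP => x xab; apply/cvgrPdist_lt => e e0.
have [d d0 H] := acf e e0.
near=> y; apply: H => //.
  by near: y; exact: withinT.
near: y; apply: (@cvg_within _ (nbhs x)).
by apply: (@nbhsx_ballx _ _ x d d0).
Unshelve. all: by end_near. Qed.

End AbsoluteContinuity.

(** * Monotonicity from the sign of the derivative *)

Section Monotone.
Context {R : realType}.
Local Notation mu := (@lebesgue_measure R).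

Let disjoint_chain (s : seq (R * R)) (a b : R) (U : set R) :
  open U ->
  (forall p, p \in s -> [/\ a <= p.1, p.1 <= p.2, p.2 <= b & `[p.1, p.2] `<=` U]) ->
  pairwise (fun p q : R * R => p.2 <= q.1) s ->
  let x (i : 'I_(size s)) := (nth (0, 0) s i).1 in
  let y (i : 'I_(size s)) := (nth (0, 0) s i).2 in
  trivIset [set: 'I_(size s)] (fun i => `]x i, y i[%classic) /\
  ((\sum_(i < size s) (y i - x i))%:E <= mu U)%E.
Proof.
move=> oU hs pw x y.
have hi (i : 'I_(size s)) := hs _ (mem_nth (0, 0) (ltn_ord i)).
have lt_disj (i j : 'I_(size s)) : (i < j)%N -> y i <= x j.
  by move=> ij; apply: (pairwiseP (0, 0) pw) => //; rewrite inE.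
have tI : trivIset [set: 'I_(size s)] (fun i => `]x i, y i[%classic).
  move=> i j _ _ [z []] /=; rewrite !in_itv/= => /andP[xi yi] /andP[xj yj].
  by apply/val_inj => /=; case: (ltngtP i j) => // /lt_disj h; exfalso; lra.
split=> //.
have -> : (\sum_(i < size s) (y i - x i))%:E =
    mu (\big[setU/set0]_(i < size s) `]x i, y i[%classic).
  rewrite measure_bigsetU_ord// -sumEFin; apply: eq_bigr => i _.
  have [_ xy _ _] := hi i.
  rewrite /= lebesgue_measure_itv/= lte_fin.
  have : x i <= y i by [].
  rewrite le_eqVlt => /predU1P[->|->]; last by rewrite EFinD.
  by rewrite ltxx subrr.
apply: le_measure; rewrite ?inE.
- by apply: bigsetU_measurable => i _; exact: measurable_itv.
- exact: open_measurable.
- rewrite -bigcup_seq_cond => z [i _] /=.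
  have [_ _ _ sU] := hi i.
  by move=> zi; apply: sU; exact: subset_itv_oo_cc zi.
Qed.

(** The proof does not use Lebesgue integration; it is a covering argument.  The
    exceptional null set is covered by an open set of small measure, over which
    the variation of [f] is small by absolute continuity, and [a, b] is cut
    into intervals that either lie in that open set or on which the difference
    quotient is almost nonnegative.  The existence of such a subdivision
    follows by taking the supremum of the points that can be reached. *)
Lemma ac_nondecreasing (f : R -> R) (a b : R) : a <= b ->
  absolutely_continuous_on a b f ->
  {ae mu, forall s, `[a, b]%classic s -> exists2 d, 0 <= d & is_derive s 1 f d} ->
  f a <= f b.
Proof.
move=> ab acf aef.
suff H e : 0 < e -> f a <= f b + e * (b - a) + e.
  apply/ler_addgt0Pr => e e0.
  have e'0 : 0 < e / (b - a + 1) by rewrite divr_gt0// ltr_wpDl// subr_ge0.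
  have := H _ e'0; congr (_ <= _).
  by rewrite -addrA -{2}(mulr1 (e / _)) -mulrDr mulfVK// gt_eqF// ltr_wpDl// subr_ge0.
move=> e0; have [d d0 acd] := acf e e0.
have [U [oU NU mU]] : exists U, [/\ open U,
   ~` [set s | `[a, b]%classic s -> exists2 d, 0 <= d & is_derive s 1 f d] `<=` U
   & (mu U < d%:E)%E].
  move/negligible_outer_measure : aef => N0.
  have d2 : 0 < d / 2 by rewrite divr_gt0.
  have [U [oU NU mU]] := outer_measure_open_le
    (~` [set s | `[a, b]%classic s -> exists2 d, 0 <= d & is_derive s 1 f d]) d2.
  exists U; split => //; apply: (le_lt_trans mU); rewrite N0 add0e lte_fin.
  by rewrite ltr_pdivrMr// ltr_pMr// ltr1n.
(* [good t]: the decrease of [f] on [a, t] is controlled, up to the slope [e],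
   by its variation over a chain of intervals contained in [U]. *)
pose good t := exists s : seq (R * R), [/\
   forall p, p \in s -> [/\ a <= p.1, p.1 <= p.2, p.2 <= t & `[p.1, p.2] `<=` U],
   pairwise (fun p q : R * R => p.2 <= q.1) s &
   f a <= f t + e * (t - a) + \sum_(p <- s) `|f p.2 - f p.1|].
have good_a : good a by exists [::]; rewrite big_nil subrr mulr0 !addr0.
(* Every point has a neighbourhood in which goodness passes from the points on
   its left to those on its right. *)
have step x : a <= x -> x <= b -> exists2 eta, 0 < eta & forall u v,
    a <= u -> u <= x -> x <= v -> v <= b -> x - u < eta -> v - x < eta ->
    good u -> good v.
  move=> ax xb; have [Ux|nUx] := pselect (U x).
    (* near a point of the open set the whole interval is put in the chain *)
    have /nbhs_ballP[eta /= eta0 xU] : nbhs x U by exact: open_nbhs_nbhs.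
    exists eta => // u v au ux xv vb xu vx [s [hs pw hf]].
    exists (rcons s (u, v)); split.
    - move=> p; rewrite mem_rcons inE => /predU1P[->/=|/hs[h1 h2 h3 h4]].
        split => //; first exact: le_trans xv.
        move=> z /=; rewrite in_itv/= => /andP[uz zv]; apply: xU.
        by rewrite /ball/= ltr_distlC; apply/andP; split; lra.
      by split => //; lra.
    - rewrite pairwise_rcons pw andbT; apply/allP => p /hs[_ _ + _] /=; exact.
    - rewrite big_rcons/=.
      have := ler_norm (f u - f v); rewrite distrC.
      have : e * (u - a) <= e * (v - a) by rewrite ler_pM2l//; lra.
      lra.
  (* elsewhere the difference quotient is at least - e *)
  have [D D0 [df Df]] : exists2 d, 0 <= d & is_derive x 1 f d.
    apply: contrapT => nD; apply: nUx; apply: NU => /= h; apply: nD; apply: h.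
    by rewrite in_itv/= ax.
  have /cvgrPdist_lt/(_ _ e0)[eta /= eta0 xD] :
      h^-1 *: (f (h *: 1 + x) - f x) @[h --> 0^'] --> D by rewrite -Df.
  have inc z : x - eta < z -> z < x + eta -> z != x ->
      `|D - (z - x)^-1 * (f z - f x)| < e.
    move=> z1 z2 zx; have := xD (z - x).
    rewrite /= sub0r normrN ltr_norml subr_eq0 => /(_ _ zx).
    by rewrite /GRing.scale/= mulr1 subrK; apply; lra.
  exists eta => // u v au ux xv vb xu vx [s [hs pw hf]].
  exists s; split => //.
    by move=> p /hs[h1 h2 h3 h4]; split => //; lra.
  have h1 : f x - f v <= e * (v - x).
    have [->|nvx] := eqVneq v x; first by rewrite !subrr mulr0.
    have vx0 : 0 < v - x by rewrite subr_gt0 lt_neqAle eq_sym nvx.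
    have := inc v ltac:(lra) ltac:(lra) nvx; rewrite ltr_norml => /andP[_ h].
    have : - e <= (v - x)^-1 * (f v - f x) by lra.
    by rewrite mulrC ler_pdivlMr//; lra.
  have h2 : f u - f x <= e * (x - u).
    have [->|nux] := eqVneq u x; first by rewrite !subrr mulr0.
    have ux0 : 0 < x - u by rewrite subr_gt0 lt_neqAle nux.
    have := inc u ltac:(lra) ltac:(lra) nux; rewrite ltr_norml => /andP[_ h].
    have : - e <= (u - x)^-1 * (f u - f x) by lra.
    by rewrite -(opprB x) -(opprB (f x)) invrN mulrNN mulrC ler_pdivlMr//; lra.
  lra.
have [s [hs pw hf]] : good b.
  pose S := [set t | [/\ a <= t, t <= b & good t]].
  have Sa : S a by split.
  have supS : has_sup S by split; [exists a|exists b => t []].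
  have ac : a <= sup S by apply: ub_le_sup => //; case: supS.
  have cb : sup S <= b by apply: ge_sup => //; [exists a|move=> t []].
  have [eta eta0 heta] := step _ ac cb.
  have [u [au ub gu] uc] := sup_adherent eta0 supS.
  have uS : u <= sup S by apply: ub_le_sup => //; case: supS.
  pose v := Num.min b (sup S + eta / 2).
  have cv : sup S <= v by rewrite le_min cb lerDl divr_ge0// ltW.
  have vb : v <= b by rewrite ge_min lexx.
  have veta : v <= sup S + eta / 2 by rewrite ge_min lexx orbT.
  have gv : good v.
    apply: (heta u) => //; first lra.
    by apply: (le_lt_trans _ (_ : eta / 2 < eta)); lra.
  have vS : v <= sup S.
    by apply: ub_le_sup; [case: supS|split => //; exact: le_trans cv].
  have : v = b.
    rewrite /v; apply/min_idPl; rewrite leNgt; apply/negP => h.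
    by move: vS; rewrite /v (min_r (ltW h)); lra.
  by move=> <-.
have [tI len] := disjoint_chain oU hs pw.
apply: (le_trans hf); rewrite lerD2l (big_nth (0, 0)) big_mkord ltW//.
apply: (acd _ (fun i => (nth (0, 0) s i).1) (fun i => (nth (0, 0) s i).2)) => //.
  by move=> i; have [] := hs _ (mem_nth (0, 0) (ltn_ord i)).
by rewrite -lte_fin (le_lt_trans len).
Qed.

End Monotone.

(** * Caratheodory primitives *)

Section Primitive.
Context {R : realType}.
Local Notation mu := (@lebesgue_measure R).

(** [f] is a primitive of [g] on [0, T] in the sense of Caratheodory: it is
    absolutely continuous and has derivative [g s] at almost every [s]. *)
Definition primitive_on {V : normedModType R} (T : R) (f g : R -> V) : Prop :=
  absolutely_continuous_on 0 T f /\ ae_on T (fun s => is_derive s 1 f (g s)).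

Lemma ae_on_mp (T : R) (P Q : R -> Prop) :
  ae_on T P -> ae_on T (fun s => P s -> Q s) -> ae_on T Q.
Proof.
apply: (@filterS2 _ _ (ae_filter_ringOfSetsType mu)).
by move=> s hP hQ sT; exact: (hQ sT (hP sT)).
Qed.

Lemma ae_on_and (T : R) (P Q : R -> Prop) :
  ae_on T P -> ae_on T Q -> ae_on T (fun s => P s /\ Q s).
Proof.
apply: (@filterS2 _ _ (ae_filter_ringOfSetsType mu)).
move=> s hP hQ sT.
by split; [exact: hP|exact: hQ].
Qed.

Lemma ae_onW (T : R) (P : R -> Prop) :
  (forall s, `[0, T]%classic s -> P s) -> ae_on T P.
Proof. by move=> h; apply: aeW => s; exact: h. Qed.

Lemma ae_onS (T : R) (P Q : R -> Prop) :
  (forall s, `[0, T]%classic s -> P s -> Q s) -> ae_on T P -> ae_on T Q.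
Proof. by move=> h /ae_on_mp; apply; exact: ae_onW. Qed.

Lemma primitive_ae_eq (V : normedModType R) (T : R) (f g h : R -> V) :
  primitive_on T f g -> ae_on T (fun s => g s = h s) -> primitive_on T f h.
Proof.
move=> [acf df] gh; split => //.
by apply: ae_onS (ae_on_and df gh) => s _ [+ <-].
Qed.

Lemma primitiveB (V : normedModType R) (T : R) (f g f' g' : R -> V) :
  primitive_on T f g -> primitive_on T f' g' ->
  primitive_on T (fun s => f s - f' s) (fun s => g s - g' s).
Proof.
move=> [acf df] [acf' df']; split.
  apply: (@ac_dominated _ _ _ _ _ _ 1 _ _ _ acf acf') => x y ax xy yb.
  by rewrite mul1r opprD addrACA -opprD (le_trans (ler_normB _ _)).
by apply: ae_onS (ae_on_and df df') => s _ [h h']; exact: is_deriveB.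
Qed.

Lemma primitiveD (V : normedModType R) (T : R) (f g f' g' : R -> V) :
  primitive_on T f g -> primitive_on T f' g' ->
  primitive_on T (fun s => f s + f' s) (fun s => g s + g' s).
Proof.
move=> [acf df] [acf' df']; split.
  apply: (@ac_dominated _ _ _ _ _ _ 1 _ _ _ acf acf') => x y ax xy yb.
  by rewrite mul1r opprD addrACA (le_trans (ler_normD _ _)).
by apply: ae_onS (ae_on_and df df') => s _ [h h']; exact: is_deriveD.
Qed.

Lemma primitive_cst (V : normedModType R) (T : R) (c : V) :
  primitive_on T (fun=> c) (fun=> 0).
Proof.
split; last by apply: ae_onW => s _; exact: is_derive_cst.
move=> e e0; exists 1 => // N x y _ _ _.
by rewrite big1// => i _; rewrite subrr normr0.
Qed.

Lemma ac_entry (p q : nat) (a b : R) (f : R -> 'M[R]_(p, q)) i j :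
  absolutely_continuous_on a b f ->
  absolutely_continuous_on a b (fun s => f s i j).
Proof.
move=> acf; apply: (@ac_lipschitz _ _ _ _ _ 1 _ _ acf) => x y _ _ _.
rewrite mul1r; have -> : f y i j - f x i j = (f y - f x) i j by rewrite !mxE.
rewrite [leRHS]/Num.Def.normr/= mx_normrE.
exact: (le_bigmax _ (fun ij => `|(f y - f x) ij.1 ij.2|) (i, j)).
Qed.

Lemma is_derive_mxP (p q : nat) (f : R -> 'M[R]_(p, q)) (s : R) D :
  is_derive s 1 f D <-> forall i j, is_derive s 1 (fun u => f u i j) (D i j).
Proof.
split=> [[df Df] i j|h].
  have dfij := (derivable_mxP _ _ _).1 df i j.
  by apply: DeriveDef => //; rewrite -Df derive_mx// mxE.
have df : derivable f s 1 by apply/derivable_mxP => i j; have [] := h i j.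
apply: DeriveDef => //; rewrite derive_mx//; apply/matrixP => i j; rewrite mxE.
by have [] := h i j.
Qed.

Lemma primitive_entry (p q : nat) (T : R) (f g : R -> 'M[R]_(p, q)) i j :
  primitive_on T f g -> primitive_on T (fun s => f s i j) (fun s => g s i j).
Proof.
move=> [acf df]; split; first exact: ac_entry.
by apply: ae_onS df => s _ /is_derive_mxP.
Qed.

Lemma primitive_le (T : R) (f g : R -> R) (x y : R) : primitive_on T f g ->
  0 <= x -> x <= y -> y <= T ->
  ae_on T (fun s => x <= s <= y -> 0 <= g s) -> f x <= f y.
Proof.
move=> [acf df] x0 xy yT g0; apply: ac_nondecreasing => //.
  exact: ac_sub acf.
move: df g0; apply: (@filterS2 _ _ (ae_filter_ringOfSetsType mu)).
move=> s dfs gs sxy.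
have xsy : x <= s <= y by move: sxy; rewrite /= in_itv.
have sT : `[0, T]%classic s.
  by move/andP: xsy => [xs sy]; rewrite /= in_itv/=; apply/andP; split; lra.
by exists (g s); [exact: gs|exact: dfs].
Qed.

Lemma primitive_increment (T : R) (f g h k : R -> R) (x y : R) :
  primitive_on T f g -> primitive_on T h k ->
  0 <= x -> x <= y -> y <= T ->
  ae_on T (fun s => x <= s <= y -> `|g s| <= k s) ->
  `|f y - f x| <= h y - h x.
Proof.
move=> fg hk x0 xy yT gk; rewrite ler_norml; apply/andP; split.
  have := primitive_le (primitiveD hk fg) x0 xy yT.
  suff: ae_on T (fun s => x <= s <= y -> 0 <= k s + g s).
    by move=> h1 h2; have := h2 h1; lra.
  by apply: ae_onS gk => s _ H /H; rewrite ler_norml => /andP[]; lra.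
have := primitive_le (primitiveB hk fg) x0 xy yT.
suff: ae_on T (fun s => x <= s <= y -> 0 <= k s - g s).
  by move=> h1 h2; have := h2 h1; lra.
by apply: ae_onS gk => s _ H /H; rewrite ler_norml => /andP[]; lra.
Qed.

Lemma mx_norm_leP (p q : nat) (M : 'M[R]_(p, q)) (c : R) : 0 <= c ->
  (`|M| <= c) <-> (forall i j, `|M i j| <= c).
Proof.
move=> c0; rewrite {1}/Num.Def.normr/= mx_normrE; split.
  move=> h i j; apply: le_trans h.
  exact: (le_bigmax _ (fun ij => `|M ij.1 ij.2|) (i, j)).
by move=> h; apply/bigmax_le => // -[i j] _ /=.
Qed.

Lemma entry_le_norm (p q : nat) (M : 'M[R]_(p, q)) i j : `|M i j| <= `|M|.
Proof. by move: i j; apply/mx_norm_leP. Qed.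

(** A mean value inequality for the maximum norm of matrices. *)
Lemma primitive_mx_increment (p q : nat) (T : R) (f g : R -> 'M[R]_(p, q))
    (h k : R -> R) (x y : R) : primitive_on T f g -> primitive_on T h k ->
  0 <= x -> x <= y -> y <= T ->
  ae_on T (fun s => x <= s <= y -> `|g s| <= k s) ->
  `|f y - f x| <= h y - h x.
Proof.
move=> fg hk x0 xy yT gk.
have hxy : h x <= h y.
  apply: (primitive_le hk) => //; apply: ae_onS gk => s _ H /H.
  exact: le_trans.
apply/mx_norm_leP => [|i j]; first by rewrite subr_ge0.
rewrite !mxE; apply: (primitive_increment (primitive_entry i j fg) hk) => //.
apply: ae_onS gk => s _ H /H; apply: le_trans; exact: entry_le_norm.
Qed.

Lemma ac_bounded (V : normedModType R) (T : R) (f : R -> V) :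
  absolutely_continuous_on 0 T f ->
  exists2 M, 0 < M & forall s, `[0, T]%classic s -> `|f s| <= M.
Proof.
move=> acf; have [T0|T0] := leP 0 T; last first.
  exists 1 => // s /=; rewrite in_itv/= => /andP[]; lra.
have acn : absolutely_continuous_on 0 T (fun s => `|f s|).
  apply: (@ac_lipschitz _ _ _ _ _ 1 _ _ acf) => x y _ _ _.
  by rewrite mul1r ler_dist_dist.
have [c _ cmax] := EVT_max T0 (ac_continuous acn).
exists (`|f c| + 1); first by rewrite ltr_wpDl.
by move=> s /cmax /le_trans; apply; rewrite lerDl.
Qed.

Lemma norm_mulmx_le (p q r : nat) (A : 'M[R]_(p, q)) (B : 'M[R]_(q, r)) :
  `|A *m B| <= q%:R * `|A| * `|B|.
Proof.
apply/mx_norm_leP => [|i j]; first by rewrite !mulr_ge0.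
rewrite mxE (le_trans (ler_norm_sum _ _ _))//.
have -> : q%:R * `|A| * `|B| = \sum_(k < q) `|A| * `|B|.
  by rewrite sumr_const card_ord -mulrA mulr_natl.
apply: ler_sum => k _; rewrite normrM.
by rewrite ler_pM//; exact: entry_le_norm.
Qed.

Lemma is_derive_mulmx (p q r : nat) (f : R -> 'M[R]_(p, q))
    (g : R -> 'M[R]_(q, r)) (s : R) df dg :
  is_derive s 1 f df -> is_derive s 1 g dg ->
  is_derive s 1 (fun u => f u *m g u) (df *m g s + f s *m dg).
Proof.
move=> /is_derive_mxP hf /is_derive_mxP hg; apply/is_derive_mxP => i j.
have -> : (fun u => (f u *m g u) i j) =
    \sum_(k < q) ((fun u => f u i k) * (fun u => g u k j)).
  by apply/funext => u; rewrite mxE fct_sumE.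
have -> : (df *m g s + f s *m dg) i j =
    \sum_(k < q) (f s i k *: dg k j + g s k j *: df i k).
  rewrite !mxE -big_split/=; apply: eq_bigr => k _.
  by rewrite /GRing.scale/= addrC [df i k * _]mulrC.
by apply: is_derive_sum => k; exact: is_deriveM.
Qed.

Lemma primitive_mulmx (p q r : nat) (T : R) (f f' : R -> 'M[R]_(p, q))
    (g g' : R -> 'M[R]_(q, r)) :
  primitive_on T f f' -> primitive_on T g g' ->
  primitive_on T (fun s => f s *m g s) (fun s => f' s *m g s + f s *m g' s).
Proof.
move=> [acf df] [acg dg]; split; last first.
  by apply: ae_onS (ae_on_and df dg) => s _ [h h']; exact: is_derive_mulmx.
have [Mf Mf0 hf] := ac_bounded acf; have [Mg Mg0 hg] := ac_bounded acg.
apply: (@ac_dominated _ _ _ _ _ _ (q%:R * (Mf + Mg)) _ _ _ acf acg).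
move=> x y x0 xy yT.
have -> : f y *m g y - f x *m g x = (f y - f x) *m g y + f x *m (g y - g x).
  by rewrite mulmxBl mulmxBr addrA subrK.
have gy : `|g y| <= Mg by apply: hg; rewrite /= in_itv/= (le_trans x0).
have fx : `|f x| <= Mf by apply: hf; rewrite /= in_itv/= x0 (le_trans xy).
rewrite (le_trans (ler_normD _ _))//.
rewrite (le_trans (lerD (norm_mulmx_le _ _) (norm_mulmx_le _ _)))//.
rewrite -!mulrA -mulrDr ler_wpM2l// mulrDr lerD//.
  by rewrite mulrC ler_wpM2r// (le_trans gy)// lerDr ltW.
by rewrite ler_wpM2r// (le_trans fx)// lerDl ltW.
Qed.

Lemma primitive_expR (T : R) (L l : R -> R) : primitive_on T L l ->
  primitive_on T (fun s => expR (L s)) (fun s => expR (L s) * l s).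
Proof.
move=> [acL dL]; split; last first.
  apply: ae_onS dL => s _ h.
  exact: (is_derive1_comp (is_derive_expR (L s)) h).
have [M M0 hM] := ac_bounded acL.
(* The tangent inequality makes the exponential Lipschitz on bounded sets. *)
have expM u v : `|u| <= M -> expR u - expR v <= expR M * `|u - v|.
  move=> uM; have uM' : expR u <= expR M by rewrite ler_expR (le_trans (ler_norm _)).
  have := expR_ge1Dx (v - u); rewrite expRB ler_pdivlMr ?expR_gt0// => h.
  have : expR u - expR v <= expR u * (u - v) by lra.
  move=> /le_trans; apply; apply: (@le_trans _ _ (expR u * `|u - v|)).
    by rewrite ler_wpM2l ?expR_ge0// ler_norm.
  by rewrite ler_wpM2r.
apply: (@ac_lipschitz _ _ _ _ _ (expR M) _ _ acL) => x y x0 xy yT.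
have Lx : `|L x| <= M by apply: hM; rewrite /= in_itv/= x0 (le_trans xy).
have Ly : `|L y| <= M by apply: hM; rewrite /= in_itv/= (le_trans x0).
rewrite ler_norml; apply/andP; split; last exact: expM.
by have := expM (L x) (L y) Lx; rewrite distrC; lra.
Qed.

Lemma primitiveZ (V : normedModType R) (T c : R) (f g : R -> V) :
  primitive_on T f g ->
  primitive_on T (fun s => c *: f s) (fun s => c *: g s).
Proof.
move=> [acf df]; split; last first.
  by apply: ae_onS df => s _ h; exact: is_deriveZ.
apply: (@ac_lipschitz _ _ _ _ _ `|c| _ _ acf) => x y _ _ _.
by rewrite -scalerBr normrZ.
Qed.

End Primitive.

Section IntegralPrimitive.
Context {R : realType}.
Local Notation mu := (@lebesgue_measure R).

(* Lebesgue differentiation gives the derivative, absolute continuity of the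
   integral gives absolute continuity. *)
Lemma integrable_primitive (T : R) (l : R -> R) :
  mu.-integrable `[0, T] (EFin \o l) -> exists f, primitive_on T f l.
Proof.
move=> intl.
pose g := l \_ `[0, T].
have intg : mu.-integrable setT (EFin \o g).
  rewrite /g -restrict_EFin; apply/integrable_restrict => //.
  by rewrite setTI.
have intgS (D : set R) : measurable D -> mu.-integrable D (EFin \o g).
  by move=> mD; apply: integrableS intg.
pose F x := (\int[mu]_(t in `]-oo, x]) g t)%R.
exists F; split; last first.
  have := @FTC1Ny R g (fun y => intgS _ (measurable_itv _))
    (open_integrable_locally openT intg).
  apply: (@filterS _ _ (ae_filter_ringOfSetsType mu)) => s [dF Fs] sT.
  apply: DeriveDef => //; rewrite -derive1E Fs /g patchE mem_set//.
have incF x y : x <= y -> `|F y - F x| <= \int[mu]_(t in `]x, y[) `|g t|.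
  move=> xy; rewrite /F Rintegral_itvB ?bnd_simp//; last exact: intgS.
  apply: (le_trans (le_normr_Rintegral _ _)) => //; first exact: intgS.
  rewrite -Rintegral_itv_bndo_bndc//.
  by apply: (integrable_norm (intgS _ _)).
move=> e e0; have [d [d0 H]] := integral_normr_continuous intg e0.
exists d => // N x y hxy tI len.
pose D := \big[setU/set0]_(i < N) `]x i, y i[%classic.
have mD : measurable D by apply: bigsetU_measurable => i _; exact: measurable_itv.
have muD : mu D = (\sum_(i < N) (y i - x i))%:E.
  rewrite measure_bigsetU_ord// -sumEFin; apply: eq_bigr => i _.
  have [_ xy _] := hxy i; rewrite /= lebesgue_measure_itv/= lte_fin.
  move: xy; rewrite le_eqVlt => /predU1P[->|->]; last by rewrite EFinD.
  by rewrite ltxx subrr.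
have muDd : (mu D < d%:E)%E by rewrite muD lte_fin.
move: (H D mD muDd); apply: le_lt_trans.
apply: (@le_trans _ _ (\sum_(i < N) \int[mu]_(t in `]x i, y i[) `|g t|)).
  by apply: ler_sum => i _; apply: incF; have [] := hxy i.
rewrite le_eqVlt; apply/orP; left; apply/eqP.
have intn (E : set R) : measurable E -> mu.-integrable E (EFin \o (fun t => `|g t|)).
  by move=> mE; exact: (integrable_norm (intgS _ mE)).
rewrite /Rintegral integral_bigsetU_EFin//=.
- rewrite sum_fine// => i _; apply: integrable_fin_num => //.
  exact: intn.
- exact: index_enum_uniq.
- by move=> i j _ _; exact: tI.
- by have /integrableP[] := intn D mD.
Qed.

End IntegralPrimitive.

(** * Caratheodory differential equations *)

Section Contraction.
Context {R : realType}.
Local Notation mu := (@lebesgue_measure R).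

(** The exponential weight turns the Volterra estimate into a contraction of
    factor 1/2, on both sides of the base point [t0]. *)
Lemma weighted_contraction (p q : nat) (T t0 M : R) (l L w : R -> R)
    (f g : R -> 'M[R]_(p, q)) :
  primitive_on T L l -> (forall s, `[0, T]%classic s -> 0 <= l s) ->
  `[0, T]%classic t0 -> 0 <= M ->
  primitive_on T f g -> f t0 = 0 ->
  ae_on T (fun s => `|g s| <= l s * w s) ->
  (forall s, `[0, T]%classic s -> w s <= M * expR (2 * `|L s - L t0|)) ->
  forall t, `[0, T]%classic t -> `|f t| <= M / 2 * expR (2 * `|L t - L t0|).
Proof.
move=> pL l0 t0T M0 pf ft0 gw wM t tT.
have Lmono x y : 0 <= x -> x <= y -> y <= T -> L x <= L y.
  move=> x0 xy yT; apply: (primitive_le pL) => //; apply: ae_onW => s sT _.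
  exact: l0.
have pexp (c e : R) : primitive_on T (fun s => c * expR (e * (L s - L t0)))
    (fun s => c * (expR (e * (L s - L t0)) * (e * l s))).
  apply: (primitiveZ c); apply: primitive_expR; apply: (primitiveZ e).
  apply: primitive_ae_eq (primitiveB pL (primitive_cst _ (L t0))) _.
  by apply: ae_onW => s _; rewrite subr0.
move: t0T tT; rewrite /= !in_itv/= => /andP[t00 t0T] /andP[t1 tT].
have [t0t|/ltW tt0] := leP t0 t.
- have := @primitive_mx_increment _ _ _ _ _ _ _ _ t0 t pf (pexp (M / 2) 2) t00 t0t tT.
  rewrite ft0 subr0 subrr mulr0 expR0 mulr1 ger0_norm ?subr_ge0 ?Lmono//.
  move=> H; apply: (@le_trans _ _ (M / 2 * expR (2 * (L t - L t0)) - M / 2)).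
    apply: H; apply: ae_onS gw => s sT gs /andP[t0s st].
    apply: (le_trans gs).
    have := wM _ sT; rewrite ger0_norm ?subr_ge0; last first.
      by apply: Lmono => //; rewrite (le_trans st).
    move=> /(ler_wpM2l (l0 _ sT)) /le_trans; apply.
    by rewrite le_eqVlt; apply/orP; left; apply/eqP; field.
  by rewrite lerBlDr lerDl divr_ge0.
- have := @primitive_mx_increment _ _ _ _ _ _ _ _ t t0 pf
    (pexp (- (M / 2)) (-2)) t1 tt0 t0T.
  rewrite ft0 sub0r normrN subrr mulr0 expR0 mulr1 ler0_norm ?subr_le0 ?Lmono//.
  move=> H; apply: (@le_trans _ _ (- (M / 2) + M / 2 * expR (-2 * (L t - L t0)))).
    rewrite mulNr opprK in H; apply: H.
    apply: ae_onS gw => s sT gs /andP[ts st0].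
    apply: (le_trans gs).
    have := wM _ sT; rewrite ler0_norm ?subr_le0; last first.
      by apply: Lmono => //; rewrite (le_trans t1).
    move=> /(ler_wpM2l (l0 _ sT)) /le_trans; apply.
    rewrite mulrN -mulNr.
    by rewrite le_eqVlt; apply/orP; left; apply/eqP; field.
  by rewrite mulrN -mulNr addrC lerBlDr lerDl divr_ge0.
Qed.

End Contraction.

Section Picard.
Context {R : realType}.
Local Notation mu := (@lebesgue_measure R).

Lemma le0_geometric (x C : R) : (forall k, x <= C / 2 ^+ k) -> x <= 0.
Proof.
move=> h; rewrite leNgt; apply/negP => x0.
have := h (Num.bound (C / x)); have := @upper_nthrootP R (C / x) _ (leqnn _).
rewrite ltr_pdivrMr// ler_pdivlMr ?exprn_gt0// mulrC => /lt_le_trans H /H.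
by rewrite ltxx.
Qed.

Let geometric_lim_real (u : nat -> R) (C : R) :
  (forall k, `|u k.+1 - u k| <= C / 2 ^+ k) ->
  exists v, forall k, `|v - u k| <= 2 * C / 2 ^+ k.
Proof.
(* [u k - r k] increases, [u k + r k] decreases, and the limit lies between. *)
move=> hu; pose r k : R := 2 * C / 2 ^+ k.
have rS k : r k = r k.+1 + C / 2 ^+ k by rewrite /r exprS; field.
pose a k := u k - r k; pose b k := u k + r k.
have aS : {homo a : m n / (m <= n)%N >-> m <= n}.
  apply/nondecreasing_seqP => k; have := hu k; rewrite ler_norml => /andP[].
  by rewrite /a (rS k); lra.
have bS : {homo b : m n / (n <= m)%N >-> m <= n}.
  move=> m n; apply: (homo_leq (r := fun x y => y <= x)) => //.
    by move=> x y z xy yz; exact: le_trans yz xy.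
  move=> k; have := hu k; rewrite ler_norml => /andP[].
  by rewrite /b (rS k); lra.
have r0 k : 0 <= r k.
  have C0 : 0 <= C.
    by have := le_trans (normr_ge0 _) (hu 0%N); rewrite expr0 divr1.
  by rewrite /r divr_ge0// ?mulr_ge0// exprn_ge0.
have ab i j : a i <= b j.
  apply: (le_trans (aS _ _ (leq_maxl i j))); apply: le_trans (bS _ _ (leq_maxr i j)).
  by rewrite /a /b; have := r0 (maxn i j); lra.
have supa : has_sup (range a).
  by split; [exists (a 0%N), 0%N|exists (b 0%N) => _ [i _ <-]].
exists (sup (range a)) => k; rewrite ler_norml -/(r k).
have h1 : a k <= sup (range a) by apply: ub_le_sup; [case: supa|exists k].
have h2 : sup (range a) <= b k by apply: ge_sup => [|_ [i _ <-]//]; case: supa.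
by move: h1 h2; rewrite /a /b => h1 h2; apply/andP; split; lra.
Qed.

(** A sequence with geometrically decreasing increments converges, with an
    explicit rate. *)
Lemma geometric_lim (p q : nat) (u : nat -> 'M[R]_(p, q)) (C : R) :
  (forall k, `|u k.+1 - u k| <= C / 2 ^+ k) ->
  exists v, forall k, `|v - u k| <= 2 * C / 2 ^+ k.
Proof.
move=> hu.
have C0 : 0 <= C.
  by have := le_trans (normr_ge0 _) (hu 0%N); rewrite expr0 divr1.
have uij i j : exists v, forall k, `|v - u k i j| <= 2 * C / 2 ^+ k.
  apply: geometric_lim_real => k; apply: le_trans (hu k).
  by have := entry_le_norm (u k.+1 - u k) i j; rewrite !mxE.
exists (\matrix_(i, j) sval (cid (uij i j))) => k.
apply/mx_norm_leP => [|i j]; first by rewrite divr_ge0 ?mulr_ge0 ?exprn_ge0.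
by rewrite !mxE; case: cid => v /= ->.
Qed.

(** Entrywise measurability of a matrix-valued function on [D]. *)
Definition measurable_mx (p q : nat) (D : set R) (M : R -> 'M[R]_(p, q)) :=
  forall i j, measurable_fun D (fun s => M s i j).

Lemma ae_on_forall (I : finType) (T : R) (P : I -> R -> Prop) :
  (forall i, ae_on T (P i)) -> ae_on T (fun s => forall i, P i s).
Proof.
move=> aP.
have : forall r : seq I, ae_on T (fun s => forall i, i \in r -> P i s).
  elim=> [|i r IH]; first by apply: ae_onW.
  apply: ae_onS (ae_on_and (aP i) IH) => s _ [h1 h2] k.
  by rewrite inE => /predU1P[->|/h2].
by move=> /(_ (enum I)); apply: ae_onS => s _ h i; apply: h; rewrite mem_enum.
Qed.

(** Absolute continuity is inherited from the dominating primitive [h]. *)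
Lemma primitive_mx (p q : nat) (T : R) (f g : R -> 'M[R]_(p, q)) (h l : R -> R) :
  (forall i j, primitive_on T (fun s => f s i j) (fun s => g s i j)) ->
  primitive_on T h l -> ae_on T (fun s => `|g s| <= l s) -> primitive_on T f g.
Proof.
move=> fg hl gl; split.
  apply: (@ac_lipschitz _ _ _ _ _ 1 _ _ hl.1) => x y x0 xy yT.
  rewrite mul1r; apply/mx_norm_leP => // i j; rewrite !mxE.
  apply: le_trans (ler_norm _); apply: (primitive_increment (fg i j) hl) => //.
  by apply: ae_onS gl => s _ + _; apply: le_trans; exact: entry_le_norm.
by apply: ae_onS (ae_on_forall (fun i => ae_on_forall (fun j => (fg i j).2)))
  => s _ ?; apply/is_derive_mxP.
Qed.

Lemma exists_primitive (p q : nat) (T t0 : R) (g : R -> 'M[R]_(p, q))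
    (l : R -> R) (c : 'M[R]_(p, q)) :
  measurable_mx `[0, T] g -> mu.-integrable `[0, T] (EFin \o l) ->
  (forall s, `[0, T]%classic s -> `|g s| <= l s) ->
  exists2 f, primitive_on T f g & f t0 = c.
Proof.
move=> mg il gl.
have gij i j : exists f, primitive_on T f (fun s => g s i j).
  apply: integrable_primitive; apply: (le_integrable _ _ _ il) => //.
    by apply/measurable_EFinP; exact: mg.
  move=> s sT; rewrite /= lee_fin (le_trans (entry_le_norm _ _ _))//.
  by rewrite (le_trans (gl _ sT))// ler_norm.
pose F i j := sval (cid (gij i j)).
have pF i j : primitive_on T (F i j) (fun s => g s i j) by rewrite /F; case: cid.
have [h hl] := integrable_primitive il.
exists (fun s => c + \matrix_(i, j) (F i j s - F i j t0)); last first.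
  by apply/matrixP => i j; rewrite !mxE subrr addr0.
apply: (primitive_mx _ hl); last exact: ae_onW.
move=> i j.
have := primitiveB (pF i j) (primitive_cst _ (F i j t0 - c i j)).
rewrite [X in primitive_on _ X _ -> _](_ : _ =
  (fun s => (c + \matrix_(i, j) (F i j s - F i j t0)) i j)); last first.
  by apply/funext => s; rewrite !mxE; ring.
by move=> /primitive_ae_eq; apply; apply: ae_onW => s _; rewrite subr0.
Qed.

Section Ode.
Variables (p q : nat) (T t0 : R) (l : R -> R).
Variables (F : R -> 'M[R]_(p, q) -> 'M[R]_(p, q)).
Hypothesis t0T : `[0, T]%classic t0.
Hypothesis il : mu.-integrable `[0, T] (EFin \o l).
Hypothesis l0 : forall s, `[0, T]%classic s -> 0 <= l s.
Hypothesis Flip : forall s, `[0, T]%classic s -> forall X Y,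
  `|F s X - F s Y| <= l s * `|X - Y|.

Let iter_contraction (L : R -> R) (Y Y' : nat -> R -> 'M[R]_(p, q)) (M : R) :
  primitive_on T L l ->
  (forall s, `[0, T]%classic s -> `|Y 0%N s - Y' 0%N s| <= M) ->
  (forall k, primitive_on T (Y k.+1) (fun s => F s (Y k s))) ->
  (forall k, primitive_on T (Y' k.+1) (fun s => F s (Y' k s))) ->
  (forall k, Y k.+1 t0 = Y' k.+1 t0) ->
  forall k t, `[0, T]%classic t ->
   `|Y k t - Y' k t| <= M / 2 ^+ k * expR (2 * `|L t - L t0|).
Proof.
move=> pL hM pY pY' Y0.
have M0 : 0 <= M by apply: le_trans (hM _ t0T).
elim=> [|k IH] t tT.
  rewrite expr0 divr1 (le_trans (hM _ tT))// ler_peMr//.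
  by rewrite -expR0 ler_expR mulr_ge0.
have := @weighted_contraction _ _ _ _ _ (M / 2 ^+ k) _ _
  (fun s => `|Y k s - Y' k s|) _ _ pL l0 t0T _ (primitiveB (pY k) (pY' k)) _ _ IH t tT.
rewrite exprS invfM [2^-1 * _]mulrC mulrA; apply.
- by rewrite divr_ge0// exprn_ge0.
- by rewrite Y0 subrr.
- by apply: ae_onW => s sT; exact: Flip.
Qed.

(** The solutions of X' = F (s, X), where [F] is Lipschitz in [X] with an
    integrable constant; the base point [t0] may be anywhere in [0, T]. *)
Theorem caratheodory_unique (Y Y' : R -> 'M[R]_(p, q)) :
  primitive_on T Y (fun s => F s (Y s)) ->
  primitive_on T Y' (fun s => F s (Y' s)) -> Y t0 = Y' t0 ->
  forall t, `[0, T]%classic t -> Y t = Y' t.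
Proof.
move=> pY pY' Y0 t tT; have [L pL] := integrable_primitive il.
have [M _ hM] := ac_bounded (primitiveB pY pY').1.
have H k := @iter_contraction L (fun=> Y) (fun=> Y') M pL hM (fun=> pY)
  (fun=> pY') (fun=> Y0) k t tT.
apply/eqP; rewrite -subr_eq0 -normr_le0.
apply: (@le0_geometric _ (M * expR (2 * `|L t - L t0|))) => k.
by rewrite mulrAC.
Qed.

(** Existence, by Picard iteration.  The uniform limit [Z] of the iterates is
    continuous, and the image of [Z] under the Picard map agrees with [Z]. *)
Theorem caratheodory_exists (c : 'M[R]_(p, q)) :
  (forall U : R -> 'M[R]_(p, q), {within `[0, T], continuous U} ->
    measurable_mx `[0, T] (fun s => F s (U s))) ->
  (forall s, `[0, T]%classic s -> `|F s 0| <= l s) ->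
  exists2 Y, primitive_on T Y (fun s => F s (Y s)) & Y t0 = c.
Proof.
move=> mF F0; have [L pL] := integrable_primitive il.
(* The Picard map, defined on continuous functions. *)
have HPhi (U : R -> 'M[R]_(p, q)) : exists V : R -> 'M[R]_(p, q),
    {within `[0, T], continuous U} ->
    primitive_on T V (fun s => F s (U s)) /\ V t0 = c.
  have [cU|] := pselect ({within `[0, T], continuous U}); last by exists U.
  have T0 : 0 <= T.
    by move: t0T; rewrite /= in_itv/= => /andP[]; exact: le_trans.
  have cnU : {within `[0, T], continuous (fun s => `|U s|)}.
    by move=> s; apply: cvg_norm; exact: cU.
  have [s0 _ hU] := EVT_max T0 cnU.
  have [|s sT|V pV V0] := @exists_primitive p q T t0 (fun s => F s (U s))
    (fun s => (1 + `|U s0|) * l s) c (mF _ cU).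
  - exact: (integrableZl _ _ il).
  - have := Flip sT (U s) 0; rewrite subr0 => h.
    have := ler_wpM2l (l0 sT) (hU s sT).
    have := ler_normB (F s (U s) - F s 0) (- F s 0).
    rewrite opprK subrK normrN; have := F0 s sT; lra.
  - by exists V.
pose Phi U := sval (cid (HPhi U)).
have hPhi U : {within `[0, T], continuous U} ->
    primitive_on T (Phi U) (fun s => F s (U s)) /\ Phi U t0 = c.
  exact: (svalP (cid (HPhi U))).
pose Y k : R -> 'M[R]_(p, q) := iter k Phi (fun=> c).
have cY k : {within `[0, T], continuous (Y k)}.
  elim: k => [|k IH]; first by move=> s; exact: cvg_cst.
  by apply: ac_continuous (hPhi _ IH).1.1.
have pY k : primitive_on T (Y k.+1) (fun s => F s (Y k s)) := (hPhi _ (cY k)).1.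
have Y0 k : Y k.+1 t0 = c := (hPhi _ (cY k)).2.
have [M _ hM] := ac_bounded (primitiveB (pY 0%N) (primitive_cst T c)).1.
have [E E0 hE] : exists2 E, 0 < E &
    forall t, `[0, T]%classic t -> expR (2 * `|L t - L t0|) <= E.
  have [N _ hN] := ac_bounded (primitiveB pL (primitive_cst T (L t0))).1.
  exists (expR (2 * N)); first exact: expR_gt0.
  by move=> t tT; rewrite ler_expR ler_pM2l// hN.
have dY t k : `[0, T]%classic t -> `|Y k.+1 t - Y k t| <= M * E / 2 ^+ k.
  move=> tT; apply: le_trans.
    by apply: (@iter_contraction L (fun k => Y k.+1) Y M) => // i; rewrite !Y0.
  have M0 : 0 <= M by apply: le_trans (hM _ t0T).
  by rewrite mulrAC ler_wpM2r ?invr_ge0 ?exprn_ge0// ler_wpM2l// hE.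
have HZ t : exists z : 'M[R]_(p, q), `[0, T]%classic t ->
    forall k, `|z - Y k t| <= 2 * (M * E) / 2 ^+ k.
  have [tT|] := pselect (`[0, T]%classic t); last by exists 0.
  have [z hz] := geometric_lim (fun k => dY t k tT).
  by exists z.
pose Z t := sval (cid (HZ t)).
have hZ t : `[0, T]%classic t -> forall k, `|Z t - Y k t| <= 2 * (M * E) / 2 ^+ k.
  exact: (svalP (cid (HZ t))).
(* Uniform limits of continuous functions are continuous. *)
have cZ : {within `[0, T], continuous Z}.
  apply/subspace_continuousP => t tT; apply/cvgrPdist_lt => e e0.
  have [k hk] : exists k, 2 * (M * E) / 2 ^+ k < e / 3.
    apply: contrapT => /forallNP h.
    have : e / 3 <= 0.
      by apply: (@le0_geometric _ (2 * (M * E))) => k; rewrite leNgt; apply/negP.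
    by rewrite leNgt divr_gt0.
  have /subspace_continuousP/(_ t tT)/cvgrPdist_lt/(_ (e / 3)) := cY k.
  rewrite divr_gt0// => /(_ isT) near_t.
  near=> y.
  have yT : `[0, T]%classic y by near: y; exact: withinT.
  have ty : `|Y k t - Y k y| < e / 3 by near: y.
  have -> : Z t - Z y = (Z t - Y k t) + (Y k t - Y k y) - (Z y - Y k y).
    by rewrite addrA subrK opprB addrA subrK.
  have := hZ t tT k; have := hZ y yT k.
  have := ler_normB (Z t - Y k t + (Y k t - Y k y)) (Z y - Y k y).
  have := ler_normD (Z t - Y k t) (Y k t - Y k y); lra.
exists (Phi Z); last exact: (hPhi _ cZ).2.
have pZ := (hPhi _ cZ).1; apply: (primitive_ae_eq pZ); apply: ae_onW => s sT.
congr (F s _); apply/eqP; rewrite -subr_eq0 -normr_le0.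
have C0 : 0 <= 2 * (M * E).
  by rewrite !mulr_ge0 ?(ltW E0)//; exact: le_trans (hM _ t0T).
apply: (@le0_geometric _ (2 * (M * E) * (1 + E))) => k.
have h1 : `|Phi Z s - Y k.+1 s| <= 2 * (M * E) / 2 ^+ k / 2 * expR (2 * `|L s - L t0|).
  apply: (@weighted_contraction _ _ _ _ _ (2 * (M * E) / 2 ^+ k) _ _
    (fun s => `|Z s - Y k s|) _ _ pL l0 t0T _ (primitiveB pZ (pY k))) => //.
  - by rewrite divr_ge0// exprn_ge0.
  - by rewrite (hPhi _ cZ).2 Y0 subrr.
  - by apply: ae_onW => u uT; exact: Flip.
  - move=> u uT; apply: (le_trans (hZ u uT k)); rewrite ler_peMr//.
      by rewrite divr_ge0// exprn_ge0.
    by rewrite -expR0 ler_expR mulr_ge0.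
have := hZ s sT k.+1; have := ler_normD (Z s - Y k.+1 s) (Y k.+1 s - Phi Z s).
rewrite addrA subrK [`|Y _ _ - _|]distrC => h2 h3; apply: (le_trans h2).
pose z : R := 2 * (M * E) / 2 ^+ k.
have z0 : 0 <= z by rewrite divr_ge0// exprn_ge0.
have zE : 0 <= z * E by rewrite mulr_ge0// ltW.
have h4 : `|Phi Z s - Y k.+1 s| <= z / 2 * E.
  by apply: (le_trans h1); rewrite ler_wpM2l ?hE// divr_ge0.
have h5 : 2 * (M * E) / 2 ^+ k.+1 = z / 2 by rewrite /z exprS; field.
have -> : 2 * (M * E) * (1 + E) / 2 ^+ k = z + z * E by rewrite /z; field.
by rewrite h5 in h3; lra.
Unshelve. all: by end_near. Qed.

End Ode.
End Picard.

(** * Positive semidefinite matrices and the resolvent *)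

Section PsdAlgebra.
Context {R : realType}.

Lemma mx_ge0P n (M : 'M[R]_n) : mx_ge M 0 <-> psd_mx M.
Proof. by rewrite /mx_ge subr0. Qed.

Lemma psd_mx0 n : psd_mx (0 : 'M[R]_n).
Proof.
by split=> [|x]; [rewrite /symmetric_mx trmx0|rewrite mulmx0 mul0mx mxE].
Qed.

Lemma psd_mxD n (M N : 'M[R]_n) : psd_mx M -> psd_mx N -> psd_mx (M + N).
Proof.
move=> [sM pM] [sN pN]; split=> [|x].
  by rewrite /symmetric_mx linearD/= sM sN.
by rewrite mulmxDr mulmxDl mxE addr_ge0.
Qed.

Lemma psd_mxZ n (c : R) (M : 'M[R]_n) : 0 <= c -> psd_mx M -> psd_mx (c *: M).
Proof.
move=> c0 [sM pM]; split=> [|x].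
  by rewrite /symmetric_mx linearZ/= sM.
by rewrite -scalemxAr -scalemxAl mxE mulr_ge0.
Qed.

Lemma psd_mx_conj p n (B : 'M[R]_(p, n)) (M : 'M[R]_n) :
  psd_mx M -> psd_mx (B *m M *m B^T).
Proof.
move=> [sM pM]; split=> [|x].
  by rewrite /symmetric_mx !trmx_mul trmxK sM mulmxA.
by have := pM (B^T *m x); rewrite trmx_mul trmxK !mulmxA.
Qed.

Lemma dot_ge0 n (x : 'cV[R]_n) : 0 <= (x^T *m x) ord0 ord0.
Proof. by rewrite mxE sumr_ge0// => i _; rewrite mxE -expr2 sqr_ge0. Qed.

Lemma dot_eq0 n (x : 'cV[R]_n) : (x^T *m x) ord0 ord0 = 0 -> x = 0.
Proof.
move=> h; apply/matrixP => i j; rewrite !ord1 [RHS]mxE.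
move: h; rewrite mxE => /eqP; rewrite psumr_eq0 => [/allP/(_ i)|k _]; last first.
  by rewrite mxE -expr2 sqr_ge0.
by rewrite mem_index_enum mxE -expr2 sqrf_eq0 => /(_ isT)/eqP.
Qed.

Lemma psd_mx1 n : psd_mx (1%:M : 'M[R]_n).
Proof.
by split=> [|x]; [rewrite /symmetric_mx trmx1|rewrite mulmx1 dot_ge0].
Qed.

Lemma psd_scalar_mx n (c : R) : 0 <= c -> psd_mx (c%:M : 'M[R]_n).
Proof. by move=> c0; rewrite -scalemx1; exact: psd_mxZ (psd_mx1 n). Qed.

Lemma qfD n (M : 'M[R]_n) (x y : 'cV[R]_n) (t : R) : symmetric_mx M ->
  ((x + t *: y)^T *m M *m (x + t *: y)) ord0 ord0 =
  (x^T *m M *m x) ord0 ord0 + 2 * t * (y^T *m M *m x) ord0 ord0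
  + t ^+ 2 * (y^T *m M *m y) ord0 ord0.
Proof.
move=> sM.
have entD (A B : 'M[R]_1) : (A + B) ord0 ord0 = A ord0 ord0 + B ord0 ord0.
  by rewrite [LHS]mxE.
have entZ (A : 'M[R]_1) c : (c *: A) ord0 ord0 = c * A ord0 ord0.
  by rewrite [LHS]mxE.
have xy : (x^T *m M *m y) ord0 ord0 = (y^T *m M *m x) ord0 ord0.
  have -> : y^T *m M *m x = (x^T *m M *m y)^T.
    by rewrite !trmx_mul trmxK sM mulmxA.
  by rewrite [RHS]mxE.
have -> : (x + t *: y)^T = x^T + t *: y^T by rewrite linearD linearZ.
rewrite !mulmxDl !mulmxDr -!scalemxAl -!scalemxAr.
by rewrite !(entD, entZ) xy; ring.
Qed.

(** Cauchy-Schwarz in disguise: the quadratic polynomial t |-> q (x + t M x) is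
    nonnegative and vanishes at 0, so its linear coefficient is zero. *)
Lemma psd_mx_ker n (M : 'M[R]_n) (x : 'cV[R]_n) : psd_mx M ->
  (x^T *m M *m x) ord0 ord0 = 0 -> M *m x = 0.
Proof.
move=> [sM pM] x0; pose y := M *m x.
pose a := (y^T *m M *m y) ord0 ord0; pose b := (y^T *m y) ord0 ord0.
have a0 : 0 <= a by exact: pM.
have b0 : 0 <= b by exact: dot_ge0.
have quad t : 0 <= a * t ^+ 2 + 2 * b * t.
  have := pM (x + t *: y); rewrite qfD// x0 add0r -/a.
  by rewrite -mulmxA -/y -/b; congr (_ <= _); ring.
(* If [b] were positive, the polynomial would be negative at - b / (a + 1). *)
apply: dot_eq0; rewrite -/y -/b; apply/eqP; rewrite eq_le b0 andbT leNgt.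
apply/negP => b1; have a1 : 0 < a + 1 by rewrite ltr_wpDl.
have := quad (- b / (a + 1)).
have -> : a * (- b / (a + 1)) ^+ 2 + 2 * b * (- b / (a + 1)) =
  - (b ^+ 2 * (a + 2) / (a + 1) ^+ 2) by field; lra.
by rewrite oppr_ge0 leNgt divr_gt0// ?mulr_gt0 ?exprn_gt0// ltr_wpDl.
Qed.

Lemma qf_delta n (M : 'M[R]_n) i j :
  ((delta_mx i 0 : 'cV[R]_n)^T *m M *m (delta_mx j 0 : 'cV[R]_n)) ord0 ord0 = M i j.
Proof. by rewrite trmx_delta -rowE -colE !mxE. Qed.

Lemma psd_mx_diag n (M : 'M[R]_n) i : psd_mx M -> 0 <= M i i.
Proof. by move=> [_ /(_ (delta_mx i 0))]; rewrite qf_delta. Qed.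

Lemma psd_mx_norm_tr n (M : 'M[R]_n) : psd_mx M -> `|M| <= \tr M.
Proof.
move=> pM; have diag0 i := psd_mx_diag i pM; have [sM qM] := pM.
have tr0 : 0 <= \tr M by rewrite sumr_ge0.
have le_tr i : M i i <= \tr M.
  by rewrite /mxtrace (bigD1 i)//= lerDl sumr_ge0.
apply/mx_norm_leP => // i j.
have Mji : M j i = M i j by rewrite -{1}sM mxE.
have h (e : R) := qM (delta_mx i 0 + e *: delta_mx j 0).
have := h 1; have := h (-1); rewrite !qfD// !qf_delta Mji.
have := le_tr i; have := le_tr j.
by rewrite ler_norml => *; apply/andP; split; lra.
Qed.

Lemma mxtrace_le_norm n (M : 'M[R]_n) : \tr M <= n%:R * `|M|.
Proof.
have -> : n%:R * `|M| = \sum_(i < n) `|M|.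
  by rewrite sumr_const card_ord mulr_natl.
by apply: ler_sum => i _; rewrite (le_trans (ler_norm _))// entry_le_norm.
Qed.

Lemma psd_mx_norm_le n (M N : 'M[R]_n) : psd_mx M -> psd_mx (N - M) ->
  `|M| <= n%:R * `|N|.
Proof.
move=> pM pNM; apply: (le_trans (psd_mx_norm_tr pM)).
apply: le_trans (mxtrace_le_norm N); rewrite -subr_ge0 -linearB/=.
by rewrite /mxtrace sumr_ge0// => i _; exact: psd_mx_diag.
Qed.

Lemma unitmx_row_ker n (M : 'M[R]_n) :
  (forall u : 'rV[R]_n, u *m M = 0 -> u = 0) -> M \in unitmx.
Proof. by move=> h; rewrite -row_free_unit; exact: inj_row_free. Qed.

Section Resolvent.
Variable n : nat.
Implicit Types P W : 'M[R]_n.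

(** The nonlinearity (I + P W)^-1 P of the Riccati equation; the inverse exists
    for positive semidefinite [P] and [W]. *)
Definition resolvent P W : 'M[R]_n := invmx (1%:M + P *m W) *m P.

Lemma resolvent_unit P W : psd_mx P -> psd_mx W -> 1%:M + P *m W \in unitmx.
Proof.
move=> pP pW; apply: unitmx_row_ker => u; rewrite mulmxDr mulmx1 => u0.
have [sP qP] := pP; have [sW qW] := pW.
have uE : u = - (u *m (P *m W)) by apply/eqP; rewrite -addr_eq0 u0.
have vE : u^T = - (W *m (P *m u^T)).
  by rewrite {1}uE linearN/= !trmx_mul sP sW mulmxA.
have q0 : (u *m P *m u^T) ord0 ord0 = 0.
  apply/eqP; rewrite eq_le; apply/andP; split; last first.
    by have := qP u^T; rewrite trmxK.
  rewrite vE mulmxN [leLHS]mxE oppr_le0.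
  have := qW (P *m u^T); rewrite trmx_mul trmxK sP !mulmxA; exact.
have Pu : P *m u^T = 0 by apply: psd_mx_ker => //; rewrite trmxK.
by rewrite -[u]trmxK vE Pu mulmx0 oppr0 trmx0.
Qed.

Let KE P W : psd_mx P -> psd_mx W ->
  [/\ invmx (1%:M + P *m W) *m (1%:M + P *m W) = 1%:M,
      (1%:M + W *m P) *m (invmx (1%:M + P *m W))^T = 1%:M
    & invmx (1%:M + P *m W) = 1%:M - resolvent P W *m W].
Proof.
move=> pP pW; have uK := resolvent_unit pP pW.
have [sP _] := pP; have [sW _] := pW.
have trE : (1%:M + P *m W)^T = 1%:M + W *m P.
  by rewrite linearD/= trmx1 trmx_mul sP sW.
split; first exact: mulVmx.
  by rewrite -trE -trmx_mul mulVmx// trmx1.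
have e : invmx (1%:M + P *m W) + resolvent P W *m W = 1%:M.
  by rewrite -[RHS](mulVmx uK) mulmxDr mulmx1 /resolvent mulmxA.
by rewrite -[LHS](addrK (resolvent P W *m W)) e.
Qed.

(* With K = (I + P W)^-1, a congruence formula that makes the sign visible:
   K P = K (P + P W P) K^T. *)
Let resolventE P W : psd_mx P -> psd_mx W ->
  resolvent P W = invmx (1%:M + P *m W) *m (P + P *m W *m P)
                  *m (invmx (1%:M + P *m W))^T.
Proof.
move=> pP pW; have [_ K2 _] := KE pP pW.
have -> : P + P *m W *m P = P *m (1%:M + W *m P).
  by rewrite mulmxDr mulmx1 mulmxA.
by rewrite -!mulmxA K2 mulmx1.
Qed.

Let psd_PWP P W : psd_mx P -> psd_mx W -> psd_mx (P *m W *m P).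
Proof. by move=> [sP _] pW; rewrite -{2}sP; exact: psd_mx_conj. Qed.

Lemma resolvent_psd P W : psd_mx P -> psd_mx W -> psd_mx (resolvent P W).
Proof.
move=> pP pW; rewrite resolventE//; apply: psd_mx_conj.
by apply: psd_mxD => //; exact: psd_PWP.
Qed.

(** As above, P - K P = K (P W P + (P W) P (P W)^T) K^T. *)
Lemma resolvent_le P W : psd_mx P -> psd_mx W -> psd_mx (P - resolvent P W).
Proof.
move=> pP pW; have [K1 K2 _] := KE pP pW; have [sP _] := pP; have [sW _] := pW.
have -> : P - resolvent P W = invmx (1%:M + P *m W) *m
    (P *m W *m P + P *m W *m P *m (P *m W)^T) *m (invmx (1%:M + P *m W))^T.
  have -> : P *m W *m P + P *m W *m P *m (P *m W)^T =
      (1%:M + P *m W) *m P *m (1%:M + W *m P) - P *m (1%:M + W *m P).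
    rewrite trmx_mul sP sW mulmxDl mul1mx [in RHS]mulmxDl addrAC subrr add0r.
    by rewrite mulmxDr mulmx1.
  by rewrite mulmxBr mulmxBl !mulmxA K1 mul1mx -!mulmxA K2 mulmx1.
apply: psd_mx_conj; apply: psd_mxD; first exact: psd_PWP.
exact: psd_mx_conj.
Qed.

Lemma resolvent_norm P W : psd_mx P -> psd_mx W ->
  `|resolvent P W| <= n%:R * `|P|.
Proof.
by move=> pP pW; apply: psd_mx_norm_le; [exact: resolvent_psd|exact: resolvent_le].
Qed.

Let norm_inv P W (a b : R) : psd_mx P -> psd_mx W -> `|P| <= a -> `|W| <= b ->
  `|invmx (1%:M + P *m W)| <= 1 + n%:R * (n%:R * a) * b.
Proof.
move=> pP pW Pa Wb; have [_ _ ->] := KE pP pW.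
apply: (le_trans (ler_normB _ _)); rewrite lerD//.
  apply/mx_norm_leP => // i j; rewrite mxE.
  by case: (i == j); rewrite ?normr1 ?normr0.
apply: (le_trans (norm_mulmx_le _ _)); rewrite ler_pM ?mulr_ge0//.
by rewrite ler_wpM2l// (le_trans (resolvent_norm pP pW))// ler_wpM2l.
Qed.

(** The resolvent identity K P - K' P' = K (P - P') K'^T, where K = I - (K P) W
    is bounded because K P is. *)
Lemma resolvent_lipschitz (a b : R) : exists2 k, 0 <= k & forall P P' W,
  psd_mx P -> psd_mx P' -> psd_mx W -> `|P| <= a -> `|P'| <= a -> `|W| <= b ->
  `|resolvent P W - resolvent P' W| <= k * `|P - P'|.
Proof.
pose c := 1 + n%:R * (n%:R * `|a|) * `|b|.
have c0 : 0 <= c by rewrite addr_ge0// !mulr_ge0.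
exists (n%:R * (n%:R * c) * c); first by rewrite !mulr_ge0.
move=> P P' W pP pP' pW Pa P'a Wb.
have [K1 K2 _] := KE pP pW; have [K1' K2' _] := KE pP' pW.
have -> : resolvent P W - resolvent P' W =
    invmx (1%:M + P *m W) *m (P - P') *m (invmx (1%:M + P' *m W))^T.
  have [sR' _] := resolvent_psd pP' pW; have [sP' _] := pP'.
  have -> : resolvent P' W = P' *m (invmx (1%:M + P' *m W))^T.
    by rewrite -sR' /resolvent trmx_mul sP'.
  have -> : P - P' = P *m (1%:M + W *m P') - (1%:M + P *m W) *m P'.
    by rewrite mulmxDr mulmxDl mulmx1 mul1mx mulmxA opprD addrACA subrr addr0.
  by rewrite mulmxBr mulmxBl !mulmxA K1 mul1mx -!mulmxA K2' mulmx1.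
have hK : `|invmx (1%:M + P *m W)| <= c.
  by apply: norm_inv => //; apply: (le_trans _ (ler_norm _)).
have hK' : `|(invmx (1%:M + P' *m W))^T| <= c.
  apply/mx_norm_leP => // i j; rewrite mxE.
  apply: (le_trans (entry_le_norm _ _ _)).
  by apply: norm_inv => //; apply: (le_trans _ (ler_norm _)).
apply: (le_trans (norm_mulmx_le _ _)).
apply: (@le_trans _ _ (n%:R * (n%:R * c * `|P - P'|) * c)).
  rewrite ler_pM ?mulr_ge0//; rewrite ler_wpM2l//.
  apply: (le_trans (norm_mulmx_le _ _)).
  by rewrite ler_wpM2r// ler_wpM2l.
by rewrite le_eqVlt; apply/orP; left; apply/eqP; ring.
Qed.

End Resolvent.

Lemma coercive_inv m (M : 'M[R]_m) (d : R) : 0 < d -> mx_ge M d%:M ->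
  [/\ M \in unitmx, psd_mx (invmx M) & `|invmx M| <= m%:R * d^-1].
Proof.
move=> d0 pN; set N := M - d%:M in pN.
have ME : M = N + d%:M by rewrite /N subrK.
have pM : psd_mx M by rewrite ME; apply: psd_mxD => //; apply/psd_scalar_mx/ltW.
have [sM qM] := pM; have [sN qN] := pN.
have uM : M \in unitmx.
  apply: unitmx_row_ker => u u0; rewrite -[u]trmxK; apply/eqP.
  rewrite trmx_eq0; apply/eqP/dot_eq0/eqP; rewrite eq_le dot_ge0 andbT.
  have := qN u^T; rewrite trmxK /N mulmxBr u0 sub0r mul_mx_scalar mulNmx.
  by rewrite -scalemxAl !mxE oppr_ge0 pmulr_rle0.
have trI : (invmx M)^T = invmx M by rewrite trmx_inv sM.
have pI : psd_mx (invmx M).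
  have -> : invmx M = invmx M *m M *m (invmx M)^T.
    by rewrite mulVmx// mul1mx trI.
  exact: psd_mx_conj.
split=> //; apply: (le_trans (@psd_mx_norm_le _ _ (d^-1)%:M pI _)).
  (* With N = M - d I, the difference I / d - M^-1 is congruent to N N / d + N. *)
  have -> : (d^-1)%:M - invmx M =
      invmx M *m (d^-1 *: (N *m 1%:M *m N^T) + N) *m (invmx M)^T.
    have -> : d^-1 *: (N *m 1%:M *m N^T) + N = d^-1 *: (M *m M) - M.
      have dM (X : 'M[R]_m) : X = d^-1 *: (X *m d%:M).
        by rewrite mul_mx_scalar scalerA mulVf ?gt_eqF// scale1r.
      rewrite mulmx1 sN -/N {3}(dM N) {3}(dM M) -scalerDr -scalerBr -mulmxDr -mulmxBr.
      by rewrite -ME mulmxBl mul_scalar_mx mulmxBr mul_mx_scalar.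
    rewrite trI mulmxBr mulmxBl -scalemxAr -scalemxAl !mulmxA mulVmx// mul1mx.
    by rewrite mulmxV// mul1mx scalemx1.
  apply: psd_mx_conj; apply: psd_mxD => //.
  apply: psd_mxZ; first by rewrite invr_ge0 ltW.
  exact/psd_mx_conj/psd_mx1.
rewrite ler_wpM2l//; apply/mx_norm_leP => [|i j]; first by rewrite invr_ge0 ltW.
rewrite mxE; case: (i == j); rewrite ?mulr1n ?mulr0n ?normr0 ?invr_ge0 ?(ltW d0)//.
by rewrite gtr0_norm ?invr_gt0.
Qed.

End PsdAlgebra.

(** * Truncation and retraction onto the psd cone *)

Section Retraction.
Context {R : realType} {n : nat}.
Implicit Types X Y : 'M[R]_n.

Lemma norm_trmx p q (M : 'M[R]_(p, q)) : `|M^T| = `|M|.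
Proof.
have h a b (N : 'M[R]_(a, b)) : `|N^T| <= `|N|.
  by apply/mx_norm_leP => // i j; rewrite mxE entry_le_norm.
by apply/le_anti; rewrite h -{1}(trmxK M) h.
Qed.

(** The symmetric part of a matrix. *)
Definition symm Y : 'M[R]_n := 2^-1 *: (Y + Y^T).

Lemma symm_symmetric Y : symmetric_mx (symm Y).
Proof. by rewrite /symmetric_mx /symm linearZ linearD/= trmxK addrC. Qed.

Lemma symm_id Y : symmetric_mx Y -> symm Y = Y.
Proof.
move=> sY; rewrite /symm sY.
have -> : Y + Y = 2 *: Y by rewrite scaler_nat mulr2n.
by rewrite scalerA mulVf ?scale1r// pnatr_eq0.
Qed.

Lemma symmB X Y : symm X - symm Y = symm (X - Y).
Proof.
rewrite /symm -scalerBr; congr (_ *: _).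
by rewrite [(X - Y)^T]linearB opprD addrACA.
Qed.

Lemma norm_symm Y : `|symm Y| <= `|Y|.
Proof.
rewrite normrZ ger0_norm ?invr_ge0// ler_pdivrMl//.
by rewrite (le_trans (ler_normD _ _))// norm_trmx; lra.
Qed.

(** Radial truncation at level [r]; it multiplies by a positive scalar, hence
    preserves the cone of positive semidefinite matrices. *)
Definition radial_factor (r : R) Y : R := r / Num.max r `|Y|.

Definition truncate (r : R) Y : 'M[R]_n := radial_factor r Y *: Y.

Section Truncate.
Variable r : R.
Hypothesis r0 : 0 < r.

Let max0 Y : 0 < Num.max r `|Y|.
Proof. by rewrite lt_max r0. Qed.

Lemma radial_factor_gt0 Y : 0 < radial_factor r Y.
Proof. by rewrite divr_gt0. Qed.

Lemma radial_factor_le1 Y : radial_factor r Y <= 1.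
Proof. by rewrite ler_pdivrMr// mul1r le_max lexx. Qed.

Lemma truncate_id Y : `|Y| <= r -> truncate r Y = Y.
Proof.
by move=> Yr; rewrite /truncate /radial_factor max_l// divff ?scale1r ?gt_eqF.
Qed.

Lemma norm_truncate Y : `|truncate r Y| <= r.
Proof.
rewrite normrZ gtr0_norm ?radial_factor_gt0// mulrAC ler_pdivrMr//.
by rewrite ler_wpM2l ?(ltW r0)// le_max lexx orbT.
Qed.

Let max_lip X Y : `|Num.max r `|X| - Num.max r `|Y| | <= `|X - Y|.
Proof.
have h (A B : 'M[R]_n) : Num.max r `|A| - Num.max r `|B| <= `|A - B|.
  rewrite lerBlDr ge_max; apply/andP; split.
    by rewrite -[leLHS]add0r lerD// le_max lexx.
  have /le_trans -> // : `|A| <= `|A - B| + `|B|.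
    by rewrite -{1}(subrK B A) ler_normD.
  by rewrite lerD2l le_max lexx orbT.
by rewrite ler_norml h andbT; have := h Y X; rewrite distrC; lra.
Qed.

Lemma truncate_lipschitz X Y : `|truncate r X - truncate r Y| <= 2 * `|X - Y|.
Proof.
have := max_lip X Y; rewrite /truncate /radial_factor.
set a := Num.max r `|X|; set b := Num.max r `|Y| => ab.
have a0 : 0 < a by exact: max0. have b0 : 0 < b by exact: max0.
have ra : r <= a by rewrite le_max lexx.
have Yb : `|Y| <= b by rewrite le_max lexx orbT.
have -> : r / a *: X - r / b *: Y = (r / a) *: (X - Y) + (r * (b - a) / (a * b)) *: Y.
  rewrite scalerBr -addrA -[in RHS]scaleNr -scalerDl; congr (_ + _).
  by rewrite -scaleNr; congr (_ *: _); field; rewrite !gt_eqF.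
have ra1 : 0 <= r / a <= 1.
  by rewrite ler_pdivrMr// mul1r ra divr_ge0// ltW.
apply: (le_trans (ler_normD _ _)); rewrite mulrDl mul1r lerD//.
  by rewrite normrZ ger0_norm ?ler_piMl//; case/andP: ra1.
rewrite normrZ.
have -> : r * (b - a) / (a * b) = (r / a) * ((b - a) / b).
  by field; rewrite !gt_eqF.
rewrite normrM (@ger0_norm _ (r / a)); last by case/andP: ra1.
rewrite [`|(b - a) / b|]normrM [`|b^-1|]gtr0_norm ?invr_gt0// -mulrA.
apply: (@le_trans _ _ (1 * `|b - a|)); last by rewrite mul1r distrC.
case/andP: ra1 => ra0 ra1.
rewrite ler_pM//; first by rewrite !mulr_ge0// invr_ge0 ltW.
by rewrite -mulrA ler_piMr// mulrC ler_pdivrMr// mul1r.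
Qed.

End Truncate.

(** For symmetric [Y], the negative part of the smallest eigenvalue, as a
    supremum over the closed unit ball; the supremum is nonnegative because the
    ball contains 0. *)
Definition neg_eig Y : R :=
  sup [set - (x^T *m Y *m x) ord0 ord0 | x in
       [set x : 'cV[R]_n | (x^T *m x) ord0 ord0 <= 1]].

Let unit_norm (x : 'cV[R]_n) : (x^T *m x) ord0 ord0 <= 1 -> `|x| <= 1.
Proof.
move=> x1; apply/mx_norm_leP => // i j; rewrite !ord1.
have : `|x i 0| ^+ 2 <= 1.
  apply: le_trans x1; rewrite real_normK ?num_real// mxE (bigD1 i)//= !mxE.
  rewrite -expr2 lerDl sumr_ge0// => k _; rewrite mxE -expr2; exact: sqr_ge0.
by rewrite expr_le1.
Qed.

Let qf_norm (x : 'cV[R]_n) Y : (x^T *m x) ord0 ord0 <= 1 ->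
  `|(x^T *m Y *m x) ord0 ord0| <= n%:R ^+ 2 * `|Y|.
Proof.
move=> /unit_norm x1; apply: (le_trans (entry_le_norm _ _ _)).
apply: (le_trans (norm_mulmx_le _ _)).
apply: (@le_trans _ _ (n%:R * `|x^T *m Y|)); first by rewrite ler_piMr// mulr_ge0.
rewrite expr2 -mulrA ler_wpM2l//; apply: (le_trans (norm_mulmx_le _ _)).
by rewrite ler_wpM2r// ler_piMr// norm_trmx.
Qed.

Let neg_eig_sup Y : has_sup [set - (x^T *m Y *m x) ord0 ord0 | x in
       [set x : 'cV[R]_n | (x^T *m x) ord0 ord0 <= 1]].
Proof.
split.
  by exists 0, 0 => /=; rewrite ?mulmx0 mxE ?oppr0.
exists (n%:R ^+ 2 * `|Y|) => _ [x x1 <-].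
by have := qf_norm Y x1; rewrite ler_norml; lra.
Qed.

Lemma neg_eig_ub Y (x : 'cV[R]_n) : (x^T *m x) ord0 ord0 <= 1 ->
  - (x^T *m Y *m x) ord0 ord0 <= neg_eig Y.
Proof.
by move=> x1; apply: ub_le_sup; [case: (neg_eig_sup Y)|exists x].
Qed.

Lemma neg_eig_ge0 Y : 0 <= neg_eig Y.
Proof.
have := @neg_eig_ub Y 0; rewrite !mulmx0 !mxE oppr0; exact.
Qed.

Lemma neg_eig_psd Y : psd_mx Y -> neg_eig Y = 0.
Proof.
move=> [_ pY]; apply/le_anti; rewrite neg_eig_ge0 andbT.
apply: ge_sup => [|_ [x _ <-]]; first by case: (neg_eig_sup Y).
by rewrite oppr_le0.
Qed.

Lemma neg_eig_lipschitz X Y : `|neg_eig X - neg_eig Y| <= n%:R ^+ 2 * `|X - Y|.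
Proof.
have h A B : neg_eig A - neg_eig B <= n%:R ^+ 2 * `|A - B|.
  rewrite lerBlDr; apply: ge_sup => [|_ [x /= x1 <-]].
    by case: (neg_eig_sup A).
  have := neg_eig_ub B x1; have := qf_norm (A - B) x1.
  rewrite mulmxBr mulmxBl.
  have -> : (x^T *m A *m x - x^T *m B *m x) ord0 ord0 =
    (x^T *m A *m x) ord0 ord0 - (x^T *m B *m x) ord0 ord0.
    by rewrite [LHS]mxE; congr (_ + _); rewrite [LHS]mxE.
  by rewrite ler_norml; lra.
by rewrite ler_norml h andbT; have := h Y X; rewrite distrC; lra.
Qed.

(** A Lipschitz retraction of the symmetric matrices onto the positive
    semidefinite ones; it need not be the metric projection. *)
Definition psd_retract Y : 'M[R]_n := Y + (neg_eig Y)%:M.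

Lemma psd_retract_psd Y : symmetric_mx Y -> psd_mx (psd_retract Y).
Proof.
move=> sY; split=> [|x].
  by rewrite /symmetric_mx linearD/= tr_scalar_mx sY.
have [x0|x0] := eqVneq ((x^T *m x) ord0 ord0) 0.
  by rewrite (dot_eq0 x0) mulmx0 mxE.
have {}x0 : 0 < (x^T *m x) ord0 ord0 by rewrite lt_neqAle eq_sym x0 dot_ge0.
pose c := Num.sqrt ((x^T *m x) ord0 ord0).
have c0 : 0 < c by rewrite sqrtr_gt0.
have c2 : c ^+ 2 = (x^T *m x) ord0 ord0 by rewrite sqr_sqrtr// ltW.
have entZ (A : 'M[R]_1) d : (d *: A) ord0 ord0 = d * A ord0 ord0.
  by rewrite [LHS]mxE.
have := @neg_eig_ub Y (c^-1 *: x).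
have -> : (c^-1 *: x)^T = c^-1 *: x^T by rewrite linearZ.
rewrite -!scalemxAl -!scalemxAr !entZ -c2.
have -> : c^-1 * (c^-1 * c ^+ 2) = 1 by field; rewrite gt_eqF.
rewrite lexx => /(_ isT) h.
rewrite /psd_retract mulmxDr mulmxDl mul_mx_scalar -scalemxAl.
rewrite [leRHS]mxE entZ -c2.
have -> : (x^T *m Y *m x) ord0 ord0 =
    c ^+ 2 * (c^-1 * (c^-1 * (x^T *m Y *m x) ord0 ord0)).
  by field; rewrite gt_eqF.
by rewrite [neg_eig Y * _]mulrC -mulrDr mulr_ge0 ?sqr_ge0//; lra.
Qed.

Lemma psd_retract_id Y : psd_mx Y -> psd_retract Y = Y.
Proof. by move=> /neg_eig_psd; rewrite /psd_retract => ->; rewrite raddf0 addr0. Qed.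

Lemma norm_scalar_mx (c : R) : `|(c%:M : 'M[R]_n)| <= `|c|.
Proof.
apply/mx_norm_leP => // i j; rewrite mxE.
by case: (i == j); rewrite ?mulr1n ?mulr0n ?normr0.
Qed.

Lemma psd_retract_lipschitz X Y :
  `|psd_retract X - psd_retract Y| <= (1 + n%:R ^+ 2) * `|X - Y|.
Proof.
rewrite /psd_retract opprD addrACA -raddfB/= mulrDl mul1r.
apply: (le_trans (ler_normD _ _)); rewrite lerD//.
exact: le_trans (norm_scalar_mx _) (neg_eig_lipschitz _ _).
Qed.

Lemma norm_psd_retract Y : `|psd_retract Y| <= (1 + n%:R ^+ 2) * `|Y|.
Proof.
have := psd_retract_lipschitz Y 0.
by rewrite (psd_retract_id (psd_mx0 n)) !subr0.
Qed.

End Retraction.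

(** * Measurability of matrix operations *)

Section MeasurableMatrices.
Context {R : realType}.
Variable D : set R.

Lemma measurable_mx_cst p q (M : 'M[R]_(p, q)) : measurable_mx D (fun=> M).
Proof. by move=> i j; exact: measurable_cst. Qed.

Lemma measurable_mxD p q (M N : R -> 'M[R]_(p, q)) :
  measurable_mx D M -> measurable_mx D N -> measurable_mx D (fun s => M s + N s).
Proof.
move=> mM mN i j; under eq_fun do rewrite mxE.
exact: measurable_funD (mM i j) (mN i j).
Qed.

Lemma measurable_mxZ p q (c : R -> R) (M : R -> 'M[R]_(p, q)) :
  measurable_fun D c -> measurable_mx D M -> measurable_mx D (fun s => c s *: M s).
Proof.
move=> mc mM i j; under eq_fun do rewrite mxE.
exact: measurable_funM mc (mM i j).
Qed.

Lemma measurable_mxN p q (M : R -> 'M[R]_(p, q)) :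
  measurable_mx D M -> measurable_mx D (fun s => - M s).
Proof.
move=> mM; under eq_fun do rewrite -scaleN1r.
by apply: measurable_mxZ => //; exact: measurable_cst.
Qed.

Lemma measurable_mx_tr p q (M : R -> 'M[R]_(p, q)) :
  measurable_mx D M -> measurable_mx D (fun s => (M s)^T).
Proof. by move=> mM i j; under eq_fun do rewrite mxE; exact: mM. Qed.

Lemma measurable_mxM p q r (M : R -> 'M[R]_(p, q)) (N : R -> 'M[R]_(q, r)) :
  measurable_mx D M -> measurable_mx D N -> measurable_mx D (fun s => M s *m N s).
Proof.
move=> mM mN i j; under eq_fun do rewrite mxE.
by apply: measurable_sum => k; exact: measurable_funM (mM i k) (mN k j).
Qed.

Lemma measurable_det n (M : R -> 'M[R]_n) :
  measurable_mx D M -> measurable_fun D (fun s => \det (M s)).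
Proof.
move=> mM; rewrite /determinant; apply: measurable_sum => g.
apply: measurable_funM; first exact: measurable_cst.
by apply: measurable_prod => i _; exact: mM.
Qed.

Lemma measurable_adj n (M : R -> 'M[R]_n) :
  measurable_mx D M -> measurable_mx D (fun s => \adj (M s)).
Proof.
move=> mM i j; under eq_fun do rewrite mxE.
apply: measurable_funM; first exact: measurable_cst.
by apply: measurable_det => k k'; under eq_fun do rewrite !mxE; exact: mM.
Qed.

Lemma measurable_invr (f : R -> R) :
  measurable_fun D f -> measurable_fun D (fun s => (f s)^-1).
Proof.
move=> mf.
have -> : (fun s => (f s)^-1) = (fun s => f s * ((f s ^+ 2) `^ (-1))).
  apply/funext => s; rewrite powR_inv1 ?sqr_ge0//.
  have [->|f0] := eqVneq (f s) 0; first by rewrite invr0 mul0r.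
  by field.
apply: measurable_funM => //.
by apply: (measurableT_comp (measurable_powR (-1))); exact: measurable_funX.
Qed.

(* The factor det M / det M is the indicator of invertibility, which makes the
   case distinction in the total inverse algebraic. *)
Lemma measurable_invmx n (M : R -> 'M[R]_n) :
  measurable_mx D M -> measurable_mx D (fun s => invmx (M s)).
Proof.
move=> mM; pose d s := \det (M s).
have md : measurable_fun D d by exact: measurable_det.
have mdV := measurable_invr md.
have mi : measurable_fun D (fun s => d s / d s) by exact: measurable_funM.
have -> : (fun s => invmx (M s)) = (fun s => (d s / d s) *: ((d s)^-1 *: \adj (M s))
    + (1 - d s / d s) *: M s).
  apply/funext => s; rewrite /invmx unitmxE unitfE -/(d s).
  have [->|d0] := eqVneq (d s) 0; first by rewrite mul0r scale0r add0r subr0 scale1r.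
  by rewrite divff// scale1r subrr scale0r addr0.
apply: measurable_mxD; apply: measurable_mxZ => //.
  by apply: measurable_mxZ => //; exact: measurable_adj.
by apply: measurable_funB => //; exact: measurable_cst.
Qed.

Lemma measurable_resolvent n (P V : R -> 'M[R]_n) :
  measurable_mx D P -> measurable_mx D V ->
  measurable_mx D (fun s => resolvent (P s) (V s)).
Proof.
move=> mP mV; apply: measurable_mxM => //; apply: measurable_invmx.
apply: measurable_mxD; first exact: measurable_mx_cst.
exact: measurable_mxM.
Qed.

Lemma lipschitz_within (V W : normedModType R) (h : V -> W) (k : R)
    (f : R -> V) : (forall x y, `|h x - h y| <= k * `|x - y|) ->
  {within D, continuous f} -> {within D, continuous (fun s => h (f s))}.
Proof.
move=> hlip /subspace_continuousP cf; apply/subspace_continuousP => t tD.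
apply/cvgrPdist_lt => e e0.
have k0 : 0 < `|k| + 1 by rewrite ltr_wpDl.
have /cvgrPdist_lt/(_ (e / (`|k| + 1))) := cf t tD.
rewrite divr_gt0// => /(_ isT) near_t.
near=> y.
have : `|f t - f y| < e / (`|k| + 1) by near: y.
rewrite ltr_pdivlMr//; apply: le_lt_trans; apply: (le_trans (hlip _ _)).
by rewrite mulrC ler_wpM2l// (le_trans (ler_norm _))// lerDl.
Unshelve. all: by end_near. Qed.

Lemma continuous_measurable_mx p q (M : R -> 'M[R]_(p, q)) : measurable D ->
  {within D, continuous M} -> measurable_mx D M.
Proof.
move=> mD cM i j; apply: subspace_continuous_measurable_fun => //.
apply: (@lipschitz_within _ _ (fun N : 'M[R]_(p, q) => N i j) 1 _ _ cM) => X Y.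
by rewrite mul1r; have := entry_le_norm (X - Y) i j; rewrite !mxE.
Qed.

End MeasurableMatrices.

(** * The Riccati equation with dominated coefficients *)

Section RiccatiOde.
Context {R : realType} {n : nat}.
Local Notation mu := (@lebesgue_measure R).
Implicit Types X Y : 'M[R]_n.

(** The right-hand side of the Riccati equation solved for the derivative, the
    control part of the equation being collected in one psd matrix [S]. *)
Definition riccati_rhs (A Q S C W : R -> 'M[R]_n) (s : R) Y : 'M[R]_n :=
  A s *m Y + Y *m (A s)^T + Y *m Q s *m Y - S s
  - C s *m resolvent Y (W s) *m (C s)^T.

(** The globally Lipschitz modification: the unknown is symmetrized, truncated
    at level [r], and its truncation retracted onto the positive semidefinite
    cone.  One of the two factors in the quadratic term is left unretracted, so
    that this term stays of the form D Y + Y D^T for symmetric [Y]. *)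
Definition riccati_trunc (A Q S C W : R -> 'M[R]_n) (r s : R) Y : 'M[R]_n :=
  let t := truncate r (symm Y) in let P := psd_retract t in
  A s *m symm Y + symm Y *m (A s)^T
  + 2^-1 *: (P *m Q s *m t + t *m Q s *m P) - S s
  - C s *m resolvent P (W s) *m (C s)^T.

Lemma norm_mulmx3_le (A B C : 'M[R]_n) :
  `|A *m B *m C| <= n%:R ^+ 2 * (`|A| * `|B| * `|C|).
Proof.
apply: (le_trans (norm_mulmx_le _ _)).
apply: (@le_trans _ _ (n%:R * (n%:R * `|A| * `|B|) * `|C|)).
  by rewrite ler_wpM2r// ler_wpM2l// norm_mulmx_le.
by rewrite le_eqVlt; apply/orP; left; apply/eqP; ring.
Qed.

Variables (T b : R) (A Q S C W : R -> 'M[R]_n) (l : R -> R).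
Hypothesis T0 : 0 < T.
Hypotheses (mA : measurable_mx `[0, T] A) (mQ : measurable_mx `[0, T] Q)
  (mS : measurable_mx `[0, T] S) (mC : measurable_mx `[0, T] C)
  (mW : measurable_mx `[0, T] W).
Hypothesis il : mu.-integrable `[0, T] (EFin \o l).
Hypotheses (hA : forall s, `[0, T]%classic s -> `|A s| <= l s)
  (hQ : forall s, `[0, T]%classic s -> `|Q s| <= l s)
  (hS : forall s, `[0, T]%classic s -> `|S s| <= l s)
  (hC : forall s, `[0, T]%classic s -> `|C s| ^+ 2 <= l s)
  (hW : forall s, `[0, T]%classic s -> `|W s| <= b).
Hypotheses (pQ : forall s, `[0, T]%classic s -> psd_mx (Q s))
  (pS : forall s, `[0, T]%classic s -> psd_mx (S s))
  (pW : forall s, `[0, T]%classic s -> psd_mx (W s)).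

Let l0 s : `[0, T]%classic s -> 0 <= l s.
Proof. by move=> sT; exact: le_trans (hA sT). Qed.

Let tT : `[0, T]%classic T.
Proof. by rewrite /= in_itv/= (ltW T0) lexx. Qed.

Local Notation F := (riccati_trunc A Q S C W).

Lemma riccati_trunc_id r s Y : 0 < r -> psd_mx Y -> `|Y| <= r ->
  F r s Y = riccati_rhs A Q S C W s Y.
Proof.
move=> r0 pY Yr; rewrite /riccati_trunc /riccati_rhs symm_id; last by case: pY.
rewrite truncate_id// psd_retract_id//; congr (_ + _ - _ - _).
have -> : Y *m Q s *m Y + Y *m Q s *m Y = 2 *: (Y *m Q s *m Y).
  by rewrite scaler_nat mulr2n.
by rewrite scalerA mulVf ?scale1r// pnatr_eq0.
Qed.

Let trunc_sym r Y : symmetric_mx (truncate r (symm Y)).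
Proof. by rewrite /symmetric_mx linearZ/= symm_symmetric. Qed.

Let P_psd r Y : psd_mx (psd_retract (truncate r (symm Y))).
Proof. by apply: psd_retract_psd; exact: trunc_sym. Qed.

Let k1 : R := 1 + n%:R ^+ 2.

Let k1_ge0 : 0 <= k1. Proof. by rewrite addr_ge0// sqr_ge0. Qed.

Let P_norm r Y : 0 < r -> `|psd_retract (truncate r (symm Y))| <= k1 * r.
Proof.
move=> r0; apply: (le_trans (norm_psd_retract _)); rewrite ler_wpM2l//.
exact: norm_truncate.
Qed.

Let t_lip r X Y : 0 < r ->
  `|truncate r (symm X) - truncate r (symm Y)| <= 2 * `|X - Y|.
Proof.
move=> r0; apply: (le_trans (truncate_lipschitz r0 _ _)).
by rewrite ler_wpM2l// symmB norm_symm.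
Qed.

Let P_lip r X Y : 0 < r ->
  `|psd_retract (truncate r (symm X)) - psd_retract (truncate r (symm Y))|
  <= (k1 * 2) * `|X - Y|.
Proof.
move=> r0; apply: (le_trans (psd_retract_lipschitz _ _)).
by rewrite -mulrA ler_wpM2l// t_lip.
Qed.

Let num (N q k r kr L d : R) :
  (2 * N + 4 * (q * k * r) + q * (kr * (k * 2))) * L * d =
  N * L * d + N * L * d
  + 2^-1 * (q * L * (k * r * (2 * d) + k * 2 * d * r)
            + q * L * (r * (k * 2 * d) + 2 * d * (k * r)))
  + q * (L * (kr * (k * 2 * d))).
Proof. by field. Qed.

Lemma riccati_trunc_lipschitz r : 0 < r -> exists2 k, 0 <= k &
  forall s, `[0, T]%classic s -> forall X Y,
    `|F r s X - F r s Y| <= k * l s * `|X - Y|.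
Proof.
move=> r0; have [kr kr0 hkr] := @resolvent_lipschitz R n (k1 * r) b.
pose q : R := n%:R ^+ 2.
have q0 : 0 <= q by exact: sqr_ge0.
exists (2 * n%:R + 4 * (q * k1 * r) + q * (kr * (k1 * 2))).
  by rewrite !addr_ge0// !mulr_ge0// ltW.
move=> s sT X Y; rewrite /riccati_trunc.
have := trunc_sym r X; have := trunc_sym r Y.
have := P_psd r X; have := P_psd r Y; have := P_norm X r0; have := P_norm Y r0.
have := t_lip X Y r0; have := P_lip X Y r0.
have := norm_truncate r0 (symm X); have := norm_truncate r0 (symm Y).
have := norm_symm (X - Y); rewrite -symmB.
set tX := truncate r (symm X); set tY := truncate r (symm Y).
set PX := psd_retract tX; set PY := psd_retract tY.
set sX := symm X; set sY := symm Y; set d := `|X - Y|.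
move=> hs tYr tXr Plip tlip PYr PXr pPY pPX stY stX.
have d0 : 0 <= d by exact: normr_ge0.
have ls := l0 sT.
have h1 : `|A s *m (sX - sY)| <= n%:R * l s * d.
  apply: (le_trans (norm_mulmx_le _ _)); rewrite -!mulrA ler_wpM2l//.
  by rewrite ler_pM// hA.
have h2 : `|(sX - sY) *m (A s)^T| <= n%:R * l s * d.
  apply: (le_trans (norm_mulmx_le _ _)); rewrite -!mulrA ler_wpM2l//.
  by rewrite mulrC ler_pM// norm_trmx hA.
have tri (M1 M2 N1 N2 : 'M[R]_n) (m1 m2 e1 e2 : R) :
    `|M1| <= m1 -> `|N2| <= m2 -> `|M1 - N1| <= e1 -> `|M2 - N2| <= e2 ->
    `|M1 *m Q s *m M2 - N1 *m Q s *m N2| <= q * l s * (m1 * e2 + e1 * m2).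
  move=> hm1 hm2 he1 he2.
  have -> : M1 *m Q s *m M2 - N1 *m Q s *m N2 =
      M1 *m Q s *m (M2 - N2) + (M1 - N1) *m Q s *m N2.
    by rewrite mulmxBr !mulmxBl addrA subrK.
  apply: (le_trans (ler_normD _ _)).
  apply: (le_trans (lerD (norm_mulmx3_le _ _ _) (norm_mulmx3_le _ _ _))).
  have -> : q * l s * (m1 * e2 + e1 * m2) =
      q * (m1 * l s * e2) + q * (e1 * l s * m2) by ring.
  rewrite lerD// ler_wpM2l// ler_pM ?mulr_ge0// ler_pM// hQ//.
have h3 := tri _ _ _ _ _ _ _ _ PXr tYr Plip tlip.
have h4 := tri _ _ _ _ _ _ _ _ tXr PYr tlip Plip.
have h5 : `|C s *m (resolvent PX (W s) - resolvent PY (W s)) *m (C s)^T| <=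
    q * (l s * (kr * (k1 * 2 * d))).
  apply: (le_trans (norm_mulmx3_le _ _ _)); rewrite ler_wpM2l//.
  rewrite norm_trmx mulrAC -expr2 ler_pM ?sqr_ge0 ?hC//.
  apply: (le_trans (hkr _ _ _ pPX pPY (pW sT) PXr PYr (hW sT))).
  by rewrite ler_wpM2l.
have -> : A s *m sX + sX *m (A s)^T + 2^-1 *: (PX *m Q s *m tX + tX *m Q s *m PX) -
    S s - C s *m resolvent PX (W s) *m (C s)^T -
   (A s *m sY + sY *m (A s)^T + 2^-1 *: (PY *m Q s *m tY + tY *m Q s *m PY) -
    S s - C s *m resolvent PY (W s) *m (C s)^T) =
   A s *m (sX - sY) + (sX - sY) *m (A s)^T
   + 2^-1 *: ((PX *m Q s *m tX - PY *m Q s *m tY)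
              + (tX *m Q s *m PX - tY *m Q s *m PY))
   - C s *m (resolvent PX (W s) - resolvent PY (W s)) *m (C s)^T.
  have lin (a a' c c' e e' g z z' : 'M[R]_n) :
      a + c + 2^-1 *: e - g - z - (a' + c' + 2^-1 *: e' - g - z') =
      (a - a') + (c - c') + 2^-1 *: (e - e') - (z - z').
    by apply/matrixP => i j; rewrite !mxE; ring.
  rewrite lin !mulmxBr !mulmxBl; congr (_ + _ + _ *: _ - _).
  by rewrite opprD addrACA.
rewrite num.
apply: (le_trans (ler_normB _ _)); apply: lerD; last exact: h5.
apply: (le_trans (ler_normD _ _)); apply: lerD.
  by apply: (le_trans (ler_normD _ _)); exact: lerD.
rewrite normrZ ger0_norm ?invr_ge0// ler_wpM2l ?invr_ge0//.
by apply: (le_trans (ler_normD _ _)); exact: lerD.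
Qed.

Let t_cont r (U : R -> 'M[R]_n) : 0 < r -> {within `[0, T], continuous U} ->
  {within `[0, T], continuous (fun s => truncate r (symm (U s)))}.
Proof.
move=> r0; apply: (@lipschitz_within _ _ _ _ (fun Y => truncate r (symm Y)) 2).
by move=> X Y; exact: t_lip.
Qed.

Let P_cont r (U : R -> 'M[R]_n) : 0 < r -> {within `[0, T], continuous U} ->
  {within `[0, T], continuous (fun s => psd_retract (truncate r (symm (U s))))}.
Proof.
move=> r0; apply: (@lipschitz_within _ _ _ _
  (fun Y => psd_retract (truncate r (symm Y))) (k1 * 2)).
by move=> X Y; exact: P_lip.
Qed.

Lemma riccati_trunc0 r s : 0 < r -> F r s 0 = - S s.
Proof.
move=> r0; rewrite riccati_trunc_id ?normr0 ?ltW//; last exact: psd_mx0.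
by rewrite /riccati_rhs /resolvent !(mulmx0, mul0mx, add0r, subr0).
Qed.

Lemma measurable_riccati_trunc r (U : R -> 'M[R]_n) : 0 < r ->
  {within `[0, T], continuous U} -> measurable_mx `[0, T] (fun s => F r s (U s)).
Proof.
move=> r0 cU.
have ms : measurable_mx `[0, T] (fun s => symm (U s)).
  apply: continuous_measurable_mx => //.
  apply: (@lipschitz_within _ _ _ _ symm 1) cU => X Y.
  by rewrite mul1r symmB norm_symm.
have mt := continuous_measurable_mx (measurable_itv _) (t_cont r0 cU).
have mP := continuous_measurable_mx (measurable_itv _) (P_cont r0 cU).
have mAt := measurable_mx_tr mA. have mCt := measurable_mx_tr mC.
apply: measurable_mxD.
  apply: measurable_mxD; last exact: measurable_mxN.
  apply: measurable_mxD; first by apply: measurable_mxD; exact: measurable_mxM.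
  apply: measurable_mxZ; first exact: measurable_cst.
  apply: measurable_mxD; apply: measurable_mxM => //; exact: measurable_mxM.
apply: measurable_mxN; apply: measurable_mxM => //; apply: measurable_mxM => //.
by apply: measurable_resolvent.
Qed.

Lemma riccati_trunc_symmetric r s Y : `[0, T]%classic s ->
  symmetric_mx (F r s Y).
Proof.
move=> sT; rewrite /symmetric_mx /riccati_trunc.
have [sQ _] := pQ sT; have [sS _] := pS sT.
have [sP _] := P_psd r Y; have st := trunc_sym r Y; have sY := symm_symmetric Y.
have [sZ _] := resolvent_psd (P_psd r Y) (pW sT).
have trD (M N : 'M[R]_n) : (M + N)^T = M^T + N^T by rewrite linearD.
have trN (M : 'M[R]_n) : (- M)^T = - M^T by rewrite linearN.
have trZ (c : R) (M : 'M[R]_n) : (c *: M)^T = c *: M^T by rewrite linearZ.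
move: sP st sY sZ.
move: (symm _) (truncate _ _) (psd_retract _) (resolvent _ _) => Ys t P Z sP st sY sZ.
rewrite !(trD, trN, trZ, trmx_mul, trmxK) sQ sS sP st sY sZ !mulmxA.
congr (_ + _ *: _ - _ - _); exact: addrC.
Qed.

Lemma riccati_trunc_tr r s Y : F r s Y^T = F r s Y.
Proof.
have sYt : symm Y^T = symm Y by rewrite /symm trmxK addrC.
by rewrite /riccati_trunc sYt.
Qed.

Lemma primitive_trmx p q (f g : R -> 'M[R]_(p, q)) : primitive_on T f g ->
  primitive_on T (fun s => (f s)^T) (fun s => (g s)^T).
Proof.
move=> [acf df]; split.
  apply: (@ac_lipschitz _ _ _ _ _ 1 _ _ acf) => x y _ _ _.
  by rewrite mul1r -linearB/= norm_trmx.
apply: ae_onS df => s _ /is_derive_mxP h; apply/is_derive_mxP => i j.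
rewrite mxE; have -> : (fun u => (f u)^T i j) = (fun u => f u j i).
  by apply/funext => u; rewrite mxE.
exact: h.
Qed.

Let F_unique r (Y Y' : R -> 'M[R]_n) : 0 < r ->
  primitive_on T Y (fun s => F r s (Y s)) ->
  primitive_on T Y' (fun s => F r s (Y' s)) -> Y T = Y' T ->
  forall t, `[0, T]%classic t -> Y t = Y' t.
Proof.
move=> r0; have [k k0 hk] := riccati_trunc_lipschitz r0.
apply: (@caratheodory_unique _ _ _ T T (fun s => k * l s)) => //.
- exact: (integrableZl _ _ il).
- by move=> s sT; rewrite mulr_ge0// l0.
Qed.

Lemma riccati_trunc_exists r : 0 < r -> exists Y : R -> 'M[R]_n,
  [/\ primitive_on T Y (fun s => F r s (Y s)), Y T = 0
    & forall s, `[0, T]%classic s -> symmetric_mx (Y s)].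
Proof.
move=> r0; have [k k0 hk] := riccati_trunc_lipschitz r0.
have [|s sT|s sT X Y|U cU|s sT|Y pY YT] := @caratheodory_exists _ n n T T
    (fun s => (k + 1) * l s) (F r) tT _ _ _ 0.
- exact: (integrableZl _ _ il).
- by rewrite mulr_ge0 ?addr_ge0// l0.
- apply: (le_trans (hk _ sT _ _)); rewrite ler_wpM2r// ler_wpM2r ?l0//.
  by rewrite lerDl.
- exact: measurable_riccati_trunc.
- rewrite riccati_trunc0// normrN (le_trans (hS sT))// ler_peMl ?l0//.
  by rewrite lerDr.
exists Y; split => //.
(* The transpose solves the same problem *)
have pYt : primitive_on T (fun s => (Y s)^T) (fun s => F r s (Y s)^T).
  apply: primitive_ae_eq (primitive_trmx pY) _; apply: ae_onW => s sT.
  rewrite riccati_trunc_tr; exact: riccati_trunc_symmetric.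
by move=> s sT; apply: (F_unique r0 pYt pY) sT; rewrite YT trmx0.
Qed.

Lemma linear_ode_exists (D : R -> 'M[R]_n) (k t0 : R) (x0 : 'cV[R]_n) :
  0 <= k -> `[0, T]%classic t0 -> measurable_mx `[0, T] D ->
  (forall s, `[0, T]%classic s -> `|D s| <= k * l s) ->
  exists2 x : R -> 'cV[R]_n, primitive_on T x (fun s => D s *m x s) & x t0 = x0.
Proof.
move=> k0 t0T mD hD.
have [|s sT|s sT X Y|U cU|s sT|x px xt] := @caratheodory_exists _ n 1 T t0
    (fun s => (n%:R * k) * l s) (fun s x => D s *m x) t0T _ _ _ x0.
- exact: (integrableZl _ _ il).
- by rewrite !mulr_ge0// l0.
- rewrite -mulmxBr; apply: (le_trans (norm_mulmx_le _ _)).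
  by rewrite ler_wpM2r// -mulrA ler_wpM2l// hD.
- by apply: measurable_mxM => //; exact: continuous_measurable_mx.
- by rewrite mulmx0 normr0 !mulr_ge0// l0.
by exists x.
Qed.

(** Positivity: along the adjoint flow x' = - D^T x, the quadratic form
    x^T Y x has derivative - x^T V x <= 0 and vanishes at time [T]. *)
Lemma lyapunov_psd (D V Y : R -> 'M[R]_n) (k : R) :
  0 <= k -> measurable_mx `[0, T] D ->
  (forall s, `[0, T]%classic s -> `|D s| <= k * l s) ->
  (forall s, `[0, T]%classic s -> psd_mx (V s)) ->
  (forall s, `[0, T]%classic s -> symmetric_mx (Y s)) ->
  primitive_on T Y (fun s => D s *m Y s + Y s *m (D s)^T - V s) -> Y T = 0 ->
  forall s, `[0, T]%classic s -> psd_mx (Y s).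
Proof.
move=> k0 mD hD pV sY pY YT t tT'; split; first exact: sY.
move=> x0.
have [|s sT|x px xt] := @linear_ode_exists (fun s => - (D s)^T) k t x0 k0 tT'.
- by apply: measurable_mxN; exact: measurable_mx_tr.
- by rewrite normrN norm_trmx hD.
have pq := primitive_entry ord0 ord0
  (primitive_mulmx (primitive_mulmx (primitive_trmx px) pY) px).
have [t0 tT1] : 0 <= t /\ t <= T by move: tT'; rewrite /= in_itv => /andP[].
have := primitive_le (primitiveB (primitive_cst T 0) pq) t0 tT1 (lexx _).
have -> : ((x T)^T *m Y T *m x T) ord0 ord0 = 0.
  by rewrite YT mulmx0 mul0mx mxE.
rewrite xt subr0 sub0r oppr_le0; apply.
apply: ae_onW => s sT _; rewrite sub0r.
have -> : ((- (D s)^T *m x s)^T *m Y s + (x s)^T *m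
    (D s *m Y s + Y s *m (D s)^T - V s)) *m x s
    + (x s)^T *m Y s *m (- (D s)^T *m x s) = - ((x s)^T *m V s *m x s).
  rewrite trmx_mul linearN/= trmxK mulmxBr mulmxDr.
  rewrite !(mulmxDl, mulmxN, mulNmx, mulmxA).
  by rewrite addrA addrA addNr add0r addrAC addrN add0r.
by rewrite mxE opprK; have [_] := pV _ sT; exact.
Qed.

Let radial_measurable r (Y : R -> 'M[R]_n) : 0 < r ->
  {within `[0, T], continuous Y} ->
  measurable_fun `[0, T] (fun s => radial_factor r (symm (Y s))).
Proof.
move=> r0 cY; apply: measurable_funM; first exact: measurable_cst.
apply: measurable_invr; apply: measurable_maxr; first exact: measurable_cst.
apply: subspace_continuous_measurable_fun => //.
apply: (@lipschitz_within _ _ _ _ (fun X => `|symm X|) 1) cY => X Z.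
rewrite mul1r (le_trans (ler_dist_dist _ _))// symmB; exact: norm_symm.
Qed.

Lemma riccati_trunc_psd r (Y : R -> 'M[R]_n) : 0 < r ->
  primitive_on T Y (fun s => F r s (Y s)) -> Y T = 0 ->
  (forall s, `[0, T]%classic s -> symmetric_mx (Y s)) ->
  forall s, `[0, T]%classic s -> psd_mx (Y s).
Proof.
move=> r0 pY YT sY.
(* For symmetric [Y] the truncation is [th Y], so the quadratic term reads
   (th / 2) (P Q Y + Y Q P). *)
pose th s := radial_factor r (symm (Y s)).
pose P s := psd_retract (truncate r (symm (Y s))).
have cY := ac_continuous pY.1.
have mP := continuous_measurable_mx (measurable_itv _) (P_cont r0 cY).
pose V s := S s + C s *m resolvent (P s) (W s) *m (C s)^T.
apply: (@lyapunov_psd (fun s => A s + (2^-1 * th s) *: (P s *m Q s)) V Y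
  (1 + n%:R * (k1 * r))) => //.
- by rewrite addr_ge0// !mulr_ge0// ltW.
- apply: measurable_mxD => //; apply: measurable_mxZ; last exact: measurable_mxM.
  by apply: measurable_funM; [exact: measurable_cst|exact: radial_measurable].
- move=> s sT; rewrite mulrDl mul1r (le_trans (ler_normD _ _))// lerD ?hA//.
  have th0 := radial_factor_gt0 r0 (symm (Y s)).
  have th1 := radial_factor_le1 r0 (symm (Y s)).
  rewrite normrZ ger0_norm; last by rewrite mulr_ge0 ?invr_ge0// ltW.
  apply: (@le_trans _ _ (1 * `|P s *m Q s|)).
    by rewrite ler_wpM2r//; move: th1; rewrite /th; lra.
  rewrite mul1r (le_trans (norm_mulmx_le _ _))// -!mulrA ler_wpM2l// mulrA.
  by rewrite ler_pM// ?hQ// P_norm.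
- move=> s sT; apply: psd_mxD; first exact: pS.
  by apply: psd_mx_conj; apply: resolvent_psd; [exact: P_psd|exact: pW].
- apply: (primitive_ae_eq pY); apply: ae_onW => s sT.
  have [sP _] := P_psd r (Y s); have [sQ _] := pQ sT.
  have -> : (A s + (2^-1 * th s) *: (P s *m Q s))^T =
      (A s)^T + (2^-1 * th s) *: (Q s *m P s).
    by rewrite [LHS]linearD; congr (_ + _); rewrite linearZ/= trmx_mul sQ sP.
  have Ys := symm_id (sY _ sT).
  have -> : F r s (Y s) = A s *m Y s + Y s *m (A s)^T
      + 2^-1 *: (P s *m Q s *m (th s *: Y s) + (th s *: Y s) *m Q s *m P s) - V s.
    have tE : truncate r (symm (Y s)) = th s *: Y s by rewrite /truncate {2}Ys.
    rewrite /riccati_trunc opprD addrA -/(P s) tE.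
    by congr (_ + _ *: _ - _ - _); rewrite Ys.
  move: (P s) (th s) (V s) => Ps ths Vs.
  rewrite mulmxDl mulmxDr -!(scalemxAl, scalemxAr) scalerDr !scalerA !mulmxA.
  by congr (_ - _); rewrite addrACA.
Qed.

Lemma primitive_mxtrace (f g : R -> 'M[R]_n) : primitive_on T f g ->
  primitive_on T (fun s => \tr (f s)) (fun s => \tr (g s)).
Proof.
move=> [acf df]; split.
  apply: (@ac_lipschitz _ _ _ _ _ n%:R _ _ acf) => x y _ _ _.
  rewrite -linearB/= ler_norml mxtrace_le_norm andbT lerNl -linearN/=.
  by rewrite (le_trans (mxtrace_le_norm _))// normrN.
apply: ae_onS df => s _ /is_derive_mxP h.
have -> : (fun u => \tr (f u)) = \sum_(i < n) (fun u => f u i i).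
  by apply/funext => u; rewrite fct_sumE.
exact: is_derive_sum.
Qed.

Lemma primitiveM (f g f' g' : R -> R) : primitive_on T f f' ->
  primitive_on T g g' ->
  primitive_on T (fun s => f s * g s) (fun s => f' s * g s + f s * g' s).
Proof.
move=> [acf df] [acg dg]; split; last first.
  apply: ae_onS (ae_on_and df dg) => s _ [h h'].
  by have := is_deriveM h h'; rewrite addrC [g s *: _]mulrC.
have [Mf Mf0 hf] := ac_bounded acf; have [Mg Mg0 hg] := ac_bounded acg.
apply: (@ac_dominated _ _ _ _ _ _ (Mf + Mg) _ _ _ acf acg).
move=> x y x0 xy yT.
have -> : f y * g y - f x * g x = (f y - f x) * g y + f x * (g y - g x) by ring.
have gy : `|g y| <= Mg by apply: hg; rewrite /= in_itv/= (le_trans x0).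
have fx : `|f x| <= Mf by apply: hf; rewrite /= in_itv/= x0 (le_trans xy).
rewrite (le_trans (ler_normD _ _))// !normrM mulrDr lerD//.
  by rewrite mulrC ler_wpM2r// (le_trans gy)// lerDr ltW.
by rewrite ler_wpM2r// (le_trans fx)// lerDl ltW.
Qed.

Let trace_num (a1 a2 a3 a4 a5 n1 n2 n4 y : R) :
  - (n2 * y) <= a1 -> - (n2 * y) <= a2 -> 0 <= a3 -> a4 <= n1 -> a5 <= n4 * y ->
  0 <= n1 * y -> 0 <= n2 -> 0 <= n4 ->
  0 <= a1 + a2 + 2^-1 * (a3 + a3) - a4 - a5 + (y + 1) * (2 * n2 + n1 + n4).
Proof. by move=> *; lra. Qed.

(** The trace of a solution obeys a linear differential inequality, hence is
    bounded independently of the truncation level: the quadratic term has a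
    favourable sign and the resolvent is dominated by its argument. *)
Lemma riccati_trunc_bound : exists2 M, 0 < M & forall r (Y : R -> 'M[R]_n),
  0 < r -> primitive_on T Y (fun s => F r s (Y s)) -> Y T = 0 ->
  (forall s, `[0, T]%classic s -> psd_mx (Y s)) ->
  forall s, `[0, T]%classic s -> `|Y s| <= M.
Proof.
have [L pL] := integrable_primitive il.
pose N : R := n%:R; have N0 : 0 <= N by [].
pose K : R := 2 * N ^+ 2 + N + N ^+ 4.
have K0 : 0 <= K by rewrite !addr_ge0// ?mulr_ge0// exprn_ge0.
exists (expR (K * L T - K * L 0)); first exact: expR_gt0.
move=> r Y r0 pY YT psdY s sT.
have [s0 sT1] : 0 <= s /\ s <= T by move: sT; rewrite /= in_itv => /andP[].
have L0s : L 0 <= L s.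
  by apply: (primitive_le pL) => //; apply: ae_onW => u uT _; exact: l0.
apply: (le_trans (psd_mx_norm_tr (psdY _ sT))).
have pe := primitive_expR (primitiveZ K pL).
(* [(tr Y + 1) exp (K L)] is nondecreasing. *)
have pz := primitiveM
  (primitiveD (primitive_mxtrace pY) (primitive_cst T (1 : R))) pe.
have := primitive_le pz s0 sT1 (lexx _).
rewrite YT mxtrace0 add0r mul1r => H.
have {}H : (\tr (Y s) + 1) * expR (K *: L s) <= expR (K *: L T).
  apply: H; apply: ae_onW => u uT _; rewrite addr0.
  rewrite [\tr _ * _]mulrC mulrCA -mulrDr (_ : K *: l u = K * l u)//.
  apply: mulr_ge0; first exact: expR_ge0.
  have pYu := psdY _ uT; have lu := l0 uT.
  have y0 : 0 <= \tr (Y u) by apply: le_trans (psd_mx_norm_tr pYu).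
  have Yy := psd_mx_norm_tr pYu.
  set y := \tr (Y u) in y0 Yy *.
  rewrite /riccati_trunc symm_id; last by case: pYu.
  have th0 := radial_factor_gt0 r0 (Y u).
  have th1 := radial_factor_le1 r0 (Y u).
  have pt : psd_mx (truncate r (Y u)) by apply: psd_mxZ => //; exact: ltW.
  have ty : `|truncate r (Y u)| <= y.
    rewrite normrZ gtr0_norm// (le_trans _ Yy)// ler_piMl//.
  rewrite psd_retract_id//.
  move: (truncate r (Y u)) pt ty => t pt ty.
  have trB (X Z : 'M[R]_n) : \tr (X - Z) = \tr X - \tr Z by rewrite linearB.
  have trD (X Z : 'M[R]_n) : \tr (X + Z) = \tr X + \tr Z by rewrite linearD.
  have trZ (c : R) (X : 'M[R]_n) : \tr (c *: X) = c * \tr X by rewrite linearZ.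
  rewrite !(trB, trD, trZ).
  have tr_abs (X : 'M[R]_n) : - (N * `|X|) <= \tr X.
    by rewrite lerNl -linearN/= (le_trans (mxtrace_le_norm _))// normrN.
  have h1 : - (N ^+ 2 * (l u * y)) <= \tr (A u *m Y u).
    apply: le_trans (tr_abs _); rewrite lerN2 expr2 -mulrA ler_wpM2l//.
    apply: (le_trans (norm_mulmx_le _ _)); rewrite -mulrA ler_wpM2l//.
    by rewrite ler_pM// hA.
  have h2 : - (N ^+ 2 * (l u * y)) <= \tr (Y u *m (A u)^T).
    apply: le_trans (tr_abs _); rewrite lerN2 expr2 -mulrA ler_wpM2l//.
    apply: (le_trans (norm_mulmx_le _ _)); rewrite -mulrA ler_wpM2l//.
    by rewrite mulrC norm_trmx ler_pM// hA.
  have h3 : 0 <= \tr (t *m Q u *m t).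
    have [st _] := pt; rewrite -{2}st.
    have h := psd_mx_conj t (pQ uT).
    by rewrite sumr_ge0// => i _; exact: psd_mx_diag.
  have h4 : \tr (S u) <= N * l u.
    by rewrite (le_trans (mxtrace_le_norm _))// ler_wpM2l// hS.
  have h5 : \tr (C u *m resolvent t (W u) *m (C u)^T) <= N ^+ 4 * (l u * y).
    apply: (le_trans (mxtrace_le_norm _)).
    have -> : N ^+ 4 * (l u * y) = N * (N ^+ 2 * (l u * (N * y))) by ring.
    rewrite ler_wpM2l//; apply: (le_trans (norm_mulmx3_le _ _ _)).
    rewrite ler_wpM2l ?exprn_ge0// norm_trmx mulrAC -expr2 ler_pM ?exprn_ge0 ?hC//.
    by apply: (le_trans (resolvent_norm pt (pW uT))); rewrite ler_wpM2l.
  have h6 : 0 <= N * l u * y by rewrite !mulr_ge0.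
  have h7 : 0 <= N ^+ 2 * l u by rewrite !mulr_ge0// exprn_ge0.
  have h8 : 0 <= N ^+ 4 * l u by rewrite !mulr_ge0// exprn_ge0.
  have -> : K * l u = 2 * (N ^+ 2 * l u) + N * l u + N ^+ 4 * l u.
    by rewrite /K; ring.
  move: h1 h2 h3 h4 h5 h6 h7 h8.
  move: (\tr (A u *m _)) (\tr (Y u *m _)) (\tr (t *m _ *m _)) (\tr (S u))
    (\tr (C u *m _ *m _)) => a1 a2 a3 a4 a5.
  rewrite [N ^+ 2 * (l u * y)]mulrA [N ^+ 4 * (l u * y)]mulrA.
  move: (N ^+ 2 * l u) (N ^+ 4 * l u) (N * l u) => n2 n4 n1.
  exact: trace_num.
have {}H : \tr (Y s) + 1 <= expR (K * L T - K * L s).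
  by rewrite expRB ler_pdivlMr ?expR_gt0.
have : \tr (Y s) <= expR (K * L T - K * L s) by lra.
move=> /le_trans; apply; rewrite ler_expR lerB// ler_wpM2l//.
Qed.

(** The truncation level is taken to be the a priori bound, at which the
    modified equation and the Riccati equation agree. *)
Theorem riccati_exists_unique : exists Y : R -> 'M[R]_n,
  [/\ forall s, `[0, T]%classic s -> psd_mx (Y s),
      primitive_on T Y (fun s => riccati_rhs A Q S C W s (Y s)),
      Y T = 0
    & forall Y' : R -> 'M[R]_n,
        (forall s, `[0, T]%classic s -> psd_mx (Y' s)) ->
        primitive_on T Y' (fun s => riccati_rhs A Q S C W s (Y' s)) ->
        Y' T = 0 -> forall s, `[0, T]%classic s -> Y' s = Y s].
Proof.
have [M M0 hM] := riccati_trunc_bound.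
have [Y [pY YT sY]] := riccati_trunc_exists M0.
have psdY := riccati_trunc_psd M0 pY YT sY.
have nY := hM M Y M0 pY YT psdY.
have pY' : primitive_on T Y (fun s => riccati_rhs A Q S C W s (Y s)).
  apply: (primitive_ae_eq pY); apply: ae_onW => s sT.
  by rewrite riccati_trunc_id//; [exact: psdY|exact: nY].
exists Y; split => // Z psdZ pZ ZT s sT.
have [N N0 hN] := ac_bounded pZ.1.
have r0 : 0 < M + N by rewrite addr_gt0.
(* Both solve the problem truncated above their bounds. *)
have pt (X : R -> 'M[R]_n) : (forall s, `[0, T]%classic s -> psd_mx (X s)) ->
    (forall s, `[0, T]%classic s -> `|X s| <= M + N) ->
    primitive_on T X (fun s => riccati_rhs A Q S C W s (X s)) ->
    primitive_on T X (fun s => F (M + N) s (X s)).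
  move=> psdX nX pX; apply: (primitive_ae_eq pX); apply: ae_onW => u uT.
  by rewrite riccati_trunc_id//; [exact: psdX|exact: nX].
apply: (F_unique r0 _ _ _ sT); last by rewrite ZT YT.
- apply: pt => // u uT; rewrite (le_trans (hN u uT))// lerDr; exact: ltW.
- apply: pt => // u uT; rewrite (le_trans (nY u uT))// lerDl; exact: ltW.
Qed.

End RiccatiOde.

(** * Coefficients in Lebesgue spaces *)

Section LebesgueCoefficients.
Context {R : realType}.
Local Notation mu := (@lebesgue_measure R).
Variables (p q : nat) (T : R) (M : R -> 'M[R]_(p, q)).

Lemma Lp_mx_measurable r : Lp_mx r T M -> measurable_mx `[0, T] M.
Proof.
move=> hM i j; apply/measurable_restrictT => //.
by have /sub_Lfun_mfun := hM i j; rewrite inE.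
Qed.

Let norm_sum (s : R) : `|M s| <= \sum_(ij : 'I_p * 'I_q) `|M s ij.1 ij.2|.
Proof.
apply/mx_norm_leP => [|i j]; first by rewrite sumr_ge0.
by rewrite (bigD1 (i, j))//= lerDl sumr_ge0.
Qed.

Lemma L1_mx_dominated : Lp_mx 1%:E T M -> exists2 l : R -> R,
  mu.-integrable `[0, T] (EFin \o l) &
  forall s, `[0, T]%classic s -> `|M s| <= l s.
Proof.
move=> hM; exists (fun s => \sum_(ij : 'I_p * 'I_q) `|M s ij.1 ij.2|) => //.
rewrite (_ : _ \o _ = fun s => (\sum_(ij : 'I_p * 'I_q) (`|M s ij.1 ij.2|)%:E)%E).
  apply: integrable_sum => // -[i j] _ /=.
  have /Lfun1_integrable := hM i j.
  rewrite -restrict_EFin => /(integrable_restrict _ _ _ _).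
  by rewrite setTI => h; apply: integrable_norm; apply: h.
by apply/funext => s /=; rewrite sumEFin.
Qed.

Lemma L2_mx_dominated : Lp_mx 2%:E T M -> exists2 l : R -> R,
  mu.-integrable `[0, T] (EFin \o l) &
  forall s, `[0, T]%classic s -> `|M s| ^+ 2 <= l s.
Proof.
move=> hM; exists (fun s => \sum_(ij : 'I_p * 'I_q) M s ij.1 ij.2 ^+ 2); last first.
  move=> s _; set c := \sum_(ij : _) _.
  have c0 : 0 <= c by rewrite sumr_ge0// => ij _; exact: sqr_ge0.
  rewrite -(sqr_sqrtr c0) lerXn2r ?nnegrE ?sqrtr_ge0//.
  apply/mx_norm_leP => [|i j]; first exact: sqrtr_ge0.
  rewrite -sqrtr_sqr ler_wsqrtr// /c (bigD1 (i, j))//= lerDl sumr_ge0// => ij _.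
  exact: sqr_ge0.
rewrite (_ : _ \o _ = fun s => (\sum_(ij : 'I_p * 'I_q) (M s ij.1 ij.2 ^+ 2)%:E)%E).
  apply: integrable_sum => // -[i j] _ /=.
  have h := Lfun2_integrable_sqr (hM i j).
  have {}h : mu.-integrable `[0, T]
      (EFin \o (fun s => ((fun s => M s i j) \_ `[0, T]) s ^+ 2)).
    by apply: integrableS h.
  by apply: eq_integrable h => // s sT /=; rewrite patchE sT.
by apply/funext => s /=; rewrite sumEFin.
Qed.

Lemma Linfty_mx_bounded : Lp_mx +oo%E T M -> exists2 b : R,
  0 <= b & ae_on T (fun s => `|M s| <= b).
Proof.
move=> hM.
have mu0 : (0 < mu [set: R])%E.
  apply: (@lt_le_trans _ _ (mu `[0, 1]%classic)).
    by rewrite lebesgue_measure_itv/= lte_fin ltr01 oppr0 adde0 lte_fin.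
  by apply: le_measure => //; rewrite inE.
have hb i j : exists b : R, ae_on T (fun s => `|M s i j| <= b).
  have /sub_Lfun_finLfun := hM i j; rewrite inE/= /finite_norm unlock /Lnorm mu0.
  set e := ess_sup _ _ => e_fin.
  have [b eb] : exists b : R, (e <= b%:E)%E.
    by case: e e_fin => [r _|//|_]; [exists r|exists 0; rewrite leNye].
  exists b; move/ess_supP : eb.
  apply: (@filterS _ _ (ae_filter_ringOfSetsType mu)) => s /= h sT.
  by move: h; rewrite patchE mem_set// lee_fin.
pose b i j := sval (cid (hb i j)).
exists (\sum_(ij : 'I_p * 'I_q) `|b ij.1 ij.2|); first by rewrite sumr_ge0.
have H i j : ae_on T (fun s => `|M s i j| <= b i j) by rewrite /b; case: cid.
apply: ae_onS (ae_on_forall (fun i => ae_on_forall (fun j => H i j))) => s _ h.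
apply/mx_norm_leP => [|i j]; first by rewrite sumr_ge0.
apply: (le_trans (h i j)); apply: (le_trans (ler_norm _)).
by rewrite (bigD1 (i, j))//= lerDl sumr_ge0.
Qed.

End LebesgueCoefficients.

Section RiccatiAe.
Context {R : realType} {n : nat}.
Local Notation mu := (@lebesgue_measure R).

(** Only almost everywhere bounds are needed, since the coefficients may be set
    to zero on a measurable null set. *)
Theorem riccati_ae (T b : R) (A Q S C W : R -> 'M[R]_n) (l : R -> R) : 0 < T ->
  measurable_mx `[0, T] A -> measurable_mx `[0, T] Q ->
  measurable_mx `[0, T] S -> measurable_mx `[0, T] C ->
  measurable_mx `[0, T] W -> mu.-integrable `[0, T] (EFin \o l) ->
  ae_on T (fun s => [/\ `|A s| <= l s, `|Q s| <= l s, `|S s| <= l s,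
                        `|C s| ^+ 2 <= l s & `|W s| <= b]) ->
  ae_on T (fun s => [/\ psd_mx (Q s), psd_mx (S s) & psd_mx (W s)]) ->
  exists Y : R -> 'M[R]_n,
  [/\ forall s, `[0, T]%classic s -> psd_mx (Y s),
      primitive_on T Y (fun s => riccati_rhs A Q S C W s (Y s)),
      Y T = 0
    & forall Y' : R -> 'M[R]_n,
        (forall s, `[0, T]%classic s -> psd_mx (Y' s)) ->
        primitive_on T Y' (fun s => riccati_rhs A Q S C W s (Y' s)) ->
        Y' T = 0 -> forall s, `[0, T]%classic s -> Y' s = Y s].
Proof.
move=> T0 mA mQ mS mC mW il hb hp.
have [N [mN N0 hN]] := ae_on_and hb hp.
pose g s : R := \1_(~` N) s.
have mg : measurable_fun `[0, T] g.
  by apply: measurable_funTS; apply: measurable_indic; exact: measurableC.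
have g01 s : g s = 0 \/ [/\ g s = 1 & ~ N s].
  rewrite /g indicE; case: (boolP (s \in ~` N)); last by left.
  by rewrite inE => nN; right.
have good s : `[0, T]%classic s -> ~ N s ->
    [/\ `|A s| <= l s, `|Q s| <= l s, `|S s| <= l s, `|C s| ^+ 2 <= l s
       & `|W s| <= b] /\ [/\ psd_mx (Q s), psd_mx (S s) & psd_mx (W s)].
  by move=> sT nN; apply: contrapT => h; apply: nN; apply: hN => /= /(_ sT).
have gE : ae_on T (fun s => g s = 1).
  exists N; split => // s; apply: contra_notP => nNs /= _.
  by rewrite /g indicE mem_set.
have il' : mu.-integrable `[0, T] (EFin \o (fun s => `|l s|)).
  exact: (integrable_norm il).
(* Properties that hold for 0 and off [N] hold for the modified coefficients. *)
have off (X : R -> 'M[R]_n) (Pr : R -> 'M[R]_n -> Prop) :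
    (forall s, `[0, T]%classic s -> Pr s 0) ->
    (forall s, `[0, T]%classic s -> ~ N s -> Pr s (X s)) ->
    forall s, `[0, T]%classic s -> Pr s (g s *: X s).
  move=> h0 hX s sT; have [->|[-> nN]] := g01 s; first by rewrite scale0r; exact: h0.
  by rewrite scale1r; exact: hX.
have bound0 s : `[0, T]%classic s -> `|0 : 'M[R]_n| <= `|l s| by rewrite normr0.
have psd0 s : `[0, T]%classic s -> psd_mx (0 : 'M[R]_n) by move=> _; exact: psd_mx0.
have [||||||||Y [psdY pY YT uY]] := @riccati_exists_unique R n T `|b|
  (fun s => g s *: A s) (fun s => g s *: Q s) (fun s => g s *: S s)
  (fun s => g s *: C s) (fun s => g s *: W s) (fun s => `|l s|) T0
  (measurable_mxZ mg mA) (measurable_mxZ mg mQ) (measurable_mxZ mg mS)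
  (measurable_mxZ mg mC) (measurable_mxZ mg mW) il'.
- apply: (off _ (fun s X => `|X| <= `|l s|)) => // s sT nN.
  by rewrite (le_trans _ (ler_norm _))//; case: (good s sT nN) => -[].
- apply: (off _ (fun s X => `|X| <= `|l s|)) => // s sT nN.
  by rewrite (le_trans _ (ler_norm _))//; case: (good s sT nN) => -[].
- apply: (off _ (fun s X => `|X| <= `|l s|)) => // s sT nN.
  by rewrite (le_trans _ (ler_norm _))//; case: (good s sT nN) => -[].
- apply: (off _ (fun s X => `|X| ^+ 2 <= `|l s|)) => s sT.
    by rewrite normr0 expr0n.
  move=> nN.
  by rewrite (le_trans _ (ler_norm _))//; case: (good s sT nN) => -[].
- apply: (off _ (fun s X => `|X| <= `|b|)) => s sT; first by rewrite normr0.
  move=> nN.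
  by rewrite (le_trans _ (ler_norm _))//; case: (good s sT nN) => -[].
- by apply: (off _ (fun s X => psd_mx X)) => // s sT nN; case: (good s sT nN) => _ [].
- by apply: (off _ (fun s X => psd_mx X)) => // s sT nN; case: (good s sT nN) => _ [].
- by apply: (off _ (fun s X => psd_mx X)) => // s sT nN; case: (good s sT nN) => _ [].
have rhsE (X : R -> 'M[R]_n) : ae_on T (fun s =>
    riccati_rhs (fun s => g s *: A s) (fun s => g s *: Q s) (fun s => g s *: S s)
      (fun s => g s *: C s) (fun s => g s *: W s) s (X s) =
    riccati_rhs A Q S C W s (X s)).
  by apply: ae_onS gE => s _ gs; rewrite /riccati_rhs gs !scale1r.
exists Y; split => //; first exact: primitive_ae_eq (rhsE Y).
move=> Y' psdY' pY' Y'T; apply: uY => //; apply: (primitive_ae_eq pY').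
by apply: ae_onS (rhsE Y') => s _ ->.
Qed.

End RiccatiAe.

Section RiccatiSolutions.
Context {R : realType}.
Local Notation mu := (@lebesgue_measure R).

Lemma Lp_mxD (p q : nat) (r : \bar R) (T : R) (M N : R -> 'M[R]_(p, q)) :
  (1 <= r)%E -> Lp_mx r T M -> Lp_mx r T N -> Lp_mx r T (fun s => M s + N s).
Proof.
move=> r1 hM hN i j.
have -> : (fun s => (M s + N s) i j) \_ `[0, T] =
    ((fun s => M s i j) \_ `[0, T]) + ((fun s => N s i j) \_ `[0, T]).
  apply/funext => s; rewrite [RHS]/GRing.add/= !patchE.
  by case: ifP; rewrite ?mxE ?addr0.
exact: (Lfun_addr_closed mu r1).2.
Qed.

Lemma integrable_add (T : R) (f g : R -> R) :
  mu.-integrable `[0, T] (EFin \o f) -> mu.-integrable `[0, T] (EFin \o g) ->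
  mu.-integrable `[0, T] (EFin \o (fun s => f s + g s)).
Proof. by move=> hf hg; exact: (integrableD _ hf hg). Qed.

Lemma norm_conj_le (p q : nat) (B : 'M[R]_(p, q)) (V : 'M[R]_q) :
  `|B *m V *m B^T| <= q%:R ^+ 2 * `|V| * `|B| ^+ 2.
Proof.
apply: (le_trans (norm_mulmx_le _ _)); rewrite norm_trmx.
apply: (@le_trans _ _ (q%:R * (q%:R * `|B| * `|V|) * `|B|)).
  by rewrite ler_wpM2r// ler_wpM2l// norm_mulmx_le.
by rewrite le_eqVlt; apply/orP; left; apply/eqP; ring.
Qed.

Lemma is_derive1P (V : normedModType R) (f : R -> V) (s : R) (d : V) :
  is_derive s 1 f d <-> derivable f s 1 /\ derive1 f s = d.
Proof. by rewrite derive1E; split=> [[]|[]] // *; exact: DeriveDef. Qed.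

Lemma riccati_eqE (V : zmodType) (d a b c e f : V) :
  d - a - b - c + e + f = 0 <-> d = a + b + c - e - f.
Proof.
have -> : d - a - b - c + e + f = d - (a + b + c - e - f).
  by rewrite !opprD !opprK !addrA.
by split=> [/eqP|->]; [rewrite subr_eq0 => /eqP|rewrite subrr].
Qed.

Section Solutions.
Variables (n m : nat) (T : R).

Lemma sigma_solutionP (A C Q R1 Y : R -> 'M[R]_n) (B : R -> 'M[R]_(n, m))
    (R2 : R -> 'M[R]_m) :
  sigma_solution T A B C Q R1 R2 Y <->
  primitive_on T Y (fun s => riccati_rhs A Q
    (fun s => B s *m invmx (R2 s) *m (B s)^T) C R1 s (Y s)) /\ Y T = 0.
Proof.
have eqv s : (derivable Y s 1 /\ derive1 Y s - A s *m Y s - Y s *m (A s)^T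
    - Y s *m Q s *m Y s + B s *m invmx (R2 s) *m (B s)^T
    + C s *m invmx (1%:M + Y s *m R1 s) *m Y s *m (C s)^T = 0) <->
    is_derive s 1 Y (riccati_rhs A Q
      (fun s => B s *m invmx (R2 s) *m (B s)^T) C R1 s (Y s)).
  by rewrite is_derive1P riccati_eqE /riccati_rhs /resolvent !mulmxA.
split=> [[acY dY YT]|[[acY dY] YT]]; split=> //; first split=> //.
  by apply: ae_onS dY => s _ /eqv.
by apply: ae_onS dY => s _ /eqv.
Qed.

Lemma gamma_solutionP (A A' C C' Q Q' R1 R1' Sigma Y : R -> 'M[R]_n)
    (B B' : R -> 'M[R]_(n, m)) (R2 R2' : R -> 'M[R]_m) :
  gamma_solution T A A' B B' C C' Q Q' R1 R1' R2 R2' Sigma Y <->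
  primitive_on T Y (fun s => riccati_rhs (fun s => A s + A' s)
    (fun s => Q s + Q' s)
    (fun s => (B s + B' s) *m invmx (R2 s + R2' s) *m (B s + B' s)^T
      + (C s + C' s) *m resolvent (Sigma s) (R1 s + R1' s) *m (C s + C' s)^T)
    (fun=> 0) (fun=> 0) s (Y s)) /\ Y T = 0.
Proof.
have eqv s : (derivable Y s 1 /\ derive1 Y s - (A s + A' s) *m Y s
    - Y s *m (A s + A' s)^T - Y s *m (Q s + Q' s) *m Y s
    + (B s + B' s) *m invmx (R2 s + R2' s) *m (B s + B' s)^T
    + (C s + C' s) *m invmx (1%:M + Sigma s *m R1 s + Sigma s *m R1' s)
      *m Sigma s *m (C s + C' s)^T = 0) <->
    is_derive s 1 Y (riccati_rhs (fun s => A s + A' s) (fun s => Q s + Q' s)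
    (fun s => (B s + B' s) *m invmx (R2 s + R2' s) *m (B s + B' s)^T
      + (C s + C' s) *m resolvent (Sigma s) (R1 s + R1' s) *m (C s + C' s)^T)
    (fun=> 0) (fun=> 0) s (Y s)).
  rewrite is_derive1P riccati_eqE /riccati_rhs !mul0mx subr0 opprD addrA.
  by rewrite /resolvent (mulmxDr (Sigma s)) addrA !mulmxA.
split=> [[acY dY YT]|[[acY dY] YT]]; split=> //; first split=> //.
  by apply: ae_onS dY => s _ /eqv.
by apply: ae_onS dY => s _ /eqv.
Qed.

Lemma riccati_dominated (A Q S C W : R -> 'M[R]_n) (lA lQ lS lC : R -> R)
    (b : R) : 0 < T ->
  measurable_mx `[0, T] A -> measurable_mx `[0, T] Q ->
  measurable_mx `[0, T] S -> measurable_mx `[0, T] C ->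
  measurable_mx `[0, T] W ->
  mu.-integrable `[0, T] (EFin \o lA) -> mu.-integrable `[0, T] (EFin \o lQ) ->
  mu.-integrable `[0, T] (EFin \o lS) -> mu.-integrable `[0, T] (EFin \o lC) ->
  ae_on T (fun s => [/\ `|A s| <= lA s, `|Q s| <= lQ s, `|S s| <= lS s,
                        `|C s| ^+ 2 <= lC s & `|W s| <= b]) ->
  ae_on T (fun s => [/\ psd_mx (Q s), psd_mx (S s) & psd_mx (W s)]) ->
  exists Y : R -> 'M[R]_n,
  [/\ C_psd T Y,
      primitive_on T Y (fun s => riccati_rhs A Q S C W s (Y s)) /\ Y T = 0
    & forall Y' : R -> 'M[R]_n, C_psd T Y' ->
        primitive_on T Y' (fun s => riccati_rhs A Q S C W s (Y' s)) /\ Y' T = 0 ->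
        forall s, `[0, T]%classic s -> Y' s = Y s].
Proof.
move=> T0 mA mQ mS mC mW iA iQ iS iC hb hp.
pose l s := lA s + lQ s + lS s + lC s.
have il : mu.-integrable `[0, T] (EFin \o l).
  by do 3 apply: integrable_add => //.
have hb' : ae_on T (fun s => [/\ `|A s| <= l s, `|Q s| <= l s, `|S s| <= l s,
                        `|C s| ^+ 2 <= l s & `|W s| <= b]).
  apply: ae_onS hb => s _ [h1 h2 h3 h4 h5].
  have := le_trans (normr_ge0 _) h1; have := le_trans (normr_ge0 _) h2.
  have := le_trans (normr_ge0 _) h3; have := le_trans (sqr_ge0 _) h4.
  by rewrite /l => *; split => //; lra.
have [Y [psdY pY YT uY]] := riccati_ae T0 mA mQ mS mC mW il hb' hp.
exists Y; split => //; first by split=> //; exact: ac_continuous pY.1.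
by move=> Y' [_ psdY'] [pY' Y'T]; exact: uY.
Qed.

End Solutions.

End RiccatiSolutions.

Section ForcingTerms.
Context {R : realType}.
Local Notation mu := (@lebesgue_measure R).

(** [S] can serve as the forcing term of the Riccati equation: it is measurable,
    almost everywhere positive semidefinite, and dominated by an integrable
    function. *)
Definition forcing (n : nat) (T : R) (S : R -> 'M[R]_n) : Prop :=
  [/\ measurable_mx `[0, T] S, ae_on T (fun s => psd_mx (S s))
    & exists2 l : R -> R, mu.-integrable `[0, T] (EFin \o l) &
        ae_on T (fun s => `|S s| <= l s)].

Lemma forcingD (n : nat) (T : R) (S S' : R -> 'M[R]_n) :
  forcing T S -> forcing T S' -> forcing T (fun s => S s + S' s).
Proof.
move=> [mS pS [l il hl]] [mS' pS' [l' il' hl']]; split.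
- exact: measurable_mxD.
- by apply: ae_onS (ae_on_and pS pS') => s _ [h h']; exact: psd_mxD.
- exists (fun s => l s + l' s); first exact: integrable_add.
  apply: ae_onS (ae_on_and hl hl') => s _ [h h'].
  by rewrite (le_trans (ler_normD _ _))// lerD.
Qed.

Lemma forcing_conj (p n : nat) (T c : R) (B : R -> 'M[R]_(n, p))
    (V : R -> 'M[R]_p) : Lp_mx 2%:E T B -> measurable_mx `[0, T] V ->
  ae_on T (fun s => psd_mx (V s)) -> ae_on T (fun s => `|V s| <= c) ->
  forcing T (fun s => B s *m V s *m (B s)^T).
Proof.
move=> hB mV pV Vc; have mB := Lp_mx_measurable hB; split.
- by apply: measurable_mxM; [exact: measurable_mxM|exact: measurable_mx_tr].
- by apply: ae_onS pV => s _; exact: psd_mx_conj.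
- have [l il hl] := L2_mx_dominated hB.
  exists (fun s => (p%:R ^+ 2 * c) * l s); first exact: (integrableZl _ _ il).
  apply: ae_onS Vc => s sT Vs; apply: (le_trans (norm_conj_le _ _)).
  by rewrite ler_pM ?mulr_ge0 ?exprn_ge0// ?hl// ler_wpM2l ?exprn_ge0.
Qed.

Lemma forcing_control (n m : nat) (T d : R) (B : R -> 'M[R]_(n, m))
    (R2 : R -> 'M[R]_m) : 0 < d -> Lp_mx 2%:E T B -> Lp_mx +oo%E T R2 ->
  ae_on T (fun s => mx_ge (R2 s) d%:M) ->
  forcing T (fun s => B s *m invmx (R2 s) *m (B s)^T).
Proof.
move=> d0 hB hR2 pR2; apply: (@forcing_conj _ _ _ (m%:R * d^-1)) => //.
- by apply: measurable_invmx; exact: Lp_mx_measurable hR2.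
- by apply: ae_onS pR2 => s _ h; have [] := coercive_inv d0 h.
- by apply: ae_onS pR2 => s _ h; have [] := coercive_inv d0 h.
Qed.

Lemma forcing_resolvent (n : nat) (T : R) (C W P : R -> 'M[R]_n) :
  Lp_mx 2%:E T C -> Lp_mx +oo%E T W -> ae_on T (fun s => psd_mx (W s)) ->
  absolutely_continuous_on 0 T P ->
  (forall s, `[0, T]%classic s -> psd_mx (P s)) ->
  forcing T (fun s => C s *m resolvent (P s) (W s) *m (C s)^T).
Proof.
move=> hC hW pW acP pP; have [M M0 hM] := ac_bounded acP.
apply: (@forcing_conj _ _ _ (n%:R * M)) => //.
- apply: measurable_resolvent; last exact: Lp_mx_measurable hW.
  by apply: continuous_measurable_mx => //; exact: ac_continuous.
- by apply: ae_onS pW => s sT h; apply: resolvent_psd => //; exact: pP.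
- apply: ae_onS pW => s sT h; apply: (le_trans (resolvent_norm (pP _ sT) h)).
  by rewrite ler_wpM2l// hM.
Qed.

End ForcingTerms.

(** * The coupled Riccati equations *)

Theorem theorem4p1 (R : realType) (T : R) (T_gt0 : 0 < T)
    (n m : nat) (n_gt0 : (0 < n)%N) (m_gt0 : (0 < m)%N)
    (A Abar C Cbar Q Qbar R1 R1bar : R -> 'M[R]_n)
    (B Bbar : R -> 'M[R]_(n, m)) (R2 R2bar : R -> 'M[R]_m)
    (G Gbar : 'M[R]_n)
    (* integrability of the coefficients of the state equation *)
    (hA : Lp_mx 1%:E T A) (hAbar : Lp_mx 1%:E T Abar)
    (hB : Lp_mx 2%:E T B) (hBbar : Lp_mx 2%:E T Bbar)
    (hC : Lp_mx 2%:E T C) (hCbar : Lp_mx 2%:E T Cbar)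
    (* symmetry and integrability of the weights *)
    (hG : symmetric_mx G) (hGbar : symmetric_mx Gbar)
    (hQ : Lp_sym_mx 1%:E T Q) (hQbar : Lp_sym_mx 1%:E T Qbar)
    (hR1 : Lp_sym_mx +oo%E T R1) (hR1bar : Lp_sym_mx +oo%E T R1bar)
    (hR2 : Lp_sym_mx +oo%E T R2) (hR2bar : Lp_sym_mx +oo%E T R2bar)
    (* positivity of the weights *)
    (hG_ge0 : mx_ge G 0) (hGGbar_ge0 : mx_ge (G + Gbar) 0)
    (hpos : exists2 delta : R, 0 < delta &
      ae_on T (fun s =>
        [/\ mx_ge (Q s) 0 /\ mx_ge (Q s + Qbar s) 0,
            mx_ge (R1 s) 0 /\ mx_ge (R1 s + R1bar s) 0
          & mx_ge (R2 s) delta%:M /\ mx_ge (R2 s + R2bar s) delta%:M])) :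
  exists Sigma : R -> 'M[R]_n,
    [/\ C_psd T Sigma /\ sigma_solution T A B C Q R1 R2 Sigma,
        forall Sigma' : R -> 'M[R]_n,
          C_psd T Sigma' -> sigma_solution T A B C Q R1 R2 Sigma' ->
          forall s, `[0, T]%classic s -> Sigma' s = Sigma s
      & exists Gamma : R -> 'M[R]_n,
          (C_psd T Gamma /\
           gamma_solution T A Abar B Bbar C Cbar Q Qbar R1 R1bar R2 R2bar
             Sigma Gamma) /\
          forall Gamma' : R -> 'M[R]_n,
            C_psd T Gamma' ->
            gamma_solution T A Abar B Bbar C Cbar Q Qbar R1 R1bar R2 R2bar
              Sigma Gamma' ->
            forall s, `[0, T]%classic s -> Gamma' s = Gamma s].
Proof.
have [d d0 pos] := hpos.
have [hQ1 _] := hQ; have [hQbar1 _] := hQbar; have [hW _] := hR1.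
have [hWbar _] := hR1bar; have [hV _] := hR2; have [hVbar _] := hR2bar.
have [lA iA lAE] := L1_mx_dominated hA.
have [lQ iQ lQE] := L1_mx_dominated hQ1.
have [lC iC lCE] := L2_mx_dominated hC.
have [b b0 Wb] := Linfty_mx_bounded hW.
have [mS pS [lS iS lSE]] : forcing T (fun s => B s *m invmx (R2 s) *m (B s)^T).
  by apply: (forcing_control d0) => //; apply: ae_onS pos => s _ [_ _ []].
have [||Sigma [cS pSigma uS]] := @riccati_dominated R n T A Q _ C R1
  lA lQ lS lC b T_gt0
  (Lp_mx_measurable hA) (Lp_mx_measurable hQ1) mS
  (Lp_mx_measurable hC) (Lp_mx_measurable hW) iA iQ iS iC.
- apply: ae_onS (ae_on_and lSE Wb) => s sT [h1 h2].
  by split => //; [exact: lAE|exact: lQE|exact: lCE].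
- apply: ae_onS (ae_on_and pos pS) => s _ [[[/mx_ge0P q _] [/mx_ge0P w _] _] h].
  by split.
exists Sigma; split.
- by split => //; apply/sigma_solutionP.
- by move=> Sigma' cS' /sigma_solutionP; exact: uS.
have one_le2 : (1 <= 2%:E :> \bar R)%E by rewrite lee_fin ler1n.
have [lA' iA' lAE'] := L1_mx_dominated (Lp_mxD (lexx _) hA hAbar).
have [lQ' iQ' lQE'] := L1_mx_dominated (Lp_mxD (lexx _) hQ1 hQbar1).
have hC' := Lp_mxD one_le2 hC hCbar.
have hB' := Lp_mxD one_le2 hB hBbar.
have hW' := Lp_mxD (leey 1) hW hWbar.
have hV' := Lp_mxD (leey 1) hV hVbar.
have [mS' pS' [lS' iS' lSE']] : forcing T (fun s =>
    (B s + Bbar s) *m invmx (R2 s + R2bar s) *m (B s + Bbar s)^T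
    + (C s + Cbar s) *m resolvent (Sigma s) (R1 s + R1bar s) *m (C s + Cbar s)^T).
  apply: forcingD.
    by apply: (forcing_control d0) => //; apply: ae_onS pos => s _ [_ _ []].
  apply: forcing_resolvent => //.
  - by apply: ae_onS pos => s _ [_ [_ /mx_ge0P]].
  - exact: pSigma.1.1.
  - exact: cS.2.
have m0 : measurable_mx `[0, T] (fun=> 0 : 'M[R]_n) by exact: measurable_mx_cst.
have i0 : (@lebesgue_measure R).-integrable `[0, T] (EFin \o (fun=> 0)).
  exact: integrable0.
(* The second equation is the first one with [C] and [R1] replaced by 0. *)
have [||Gamma [cG pGamma uG]] := @riccati_dominated R n T _ _ _ (fun=> 0) (fun=> 0)
  lA' lQ' lS' (fun=> 0) 0 T_gt0
  (Lp_mx_measurable (Lp_mxD (lexx _) hA hAbar))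
  (Lp_mx_measurable (Lp_mxD (lexx _) hQ1 hQbar1)) mS'
  m0 m0 iA' iQ' iS' i0.
- apply: ae_onS lSE' => s sT h.
  by split; rewrite ?normr0 ?expr0n//; [exact: lAE'|exact: lQE'].
- apply: ae_onS (ae_on_and pos pS') => s _ [[[_ /mx_ge0P q] _ _] h].
  by split => //; exact: psd_mx0.
exists Gamma; split.
  by split => //; apply/gamma_solutionP.
by move=> Gamma' cG' /gamma_solutionP; exact: uG.
Qed.
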